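(* Consider the planted submatrix problem with parameters $n \ge 1$, $\lambda \ge 0$, $\rho\in(0,1)$, and target $x = v_1$. (i) For any $0<r<1$ and integer $D \ge 1$, if $\lambda \le \frac{r}{D(D+1)} \min\{1, \frac{1}{\rho\sqrt n}\}$, then $\mathrm{MMSE}_{\le D} \ge \rho - \rho^2/(1-r^2)^2$. (ii) For any $0<r<1$ and odd integer $D\ge 1$, if \[ \lambda \ge \frac{24}{r}\sqrt{\log 8 + 2D\log(9/\rho)}\,\min\Big\{1,\frac{1}{\rho\sqrt n}\Big\} \quad\text{and}\quad \frac{324}{r^2 n}\big[\log 8 + 2D\log(9/\rho)\big] \le \rho \le 1/2, \] then $\mathrm{MMSE}_{\le D} \le D^2 r^{D-1}$.
   Context: Planted submatrix problem: observe the $n\times n$ matrix $Y = \lambda v v^\top + W$, where $v\in\{0,1\}^n$ has i.i.d. $\mathrm{Bernoulli}(\rho)$ entries, and $W$ is symmetric with $W_{ij}=W_{ji}\sim\mathcal{N}(0,1)$ for $i<j$, $W_{ii}\sim\mathcal{N}(0,2)$, the variables $\{W_{ij}: i\le j\}$ independent and independent of $v$. The parameters $\lambda,\rho$ are known. $\mathrm{MMSE}_{\le D} = \inf_{f} \mathbb{E}(f(Y)-x)^2$, infimum over real polynomials $f$ of degree at most $D$ in the entries of $Y$, expectation over the joint law of $(v,W)$. Logarithms are natural. *)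

(* Defs.v *)
From HB Require Import structures.
From mathcomp Require Import all_boot all_order all_algebra.
From mathcomp Require Import all_classical all_reals all_analysis.
Set Implicit Arguments. Unset Strict Implicit. Unset Printing Implicit Defensive.
Import Order.TTheory GRing.Theory Num.Theory.
Local Open Scope classical_set_scope.
Local Open Scope ring_scope.

Definition monomial (n D : nat) := {ffun 'I_n * 'I_n -> 'I_D.+1}.

Definition mdeg (n D : nat) (m : monomial n D) : nat := (\sum_(ij : 'I_n * 'I_n) (m ij : nat))%N.

(* Evaluation at the matrix Y of the polynomial of total degree <= D with
   coefficient c m in front of the monomial m. Every real polynomial of degree
   <= D in the entries of Y is of this form for some c. *)
Definition poly_eval {R : realType} (n D : nat) (c : monomial n D -> R)
  (Y : 'I_n -> 'I_n -> R) : R :=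
  \sum_(m : monomial n D | (mdeg m <= D)%N)
     c m * \prod_(ij : 'I_n * 'I_n) Y ij.1 ij.2 ^+ (m ij : nat).

Definition mmse_le {R : realType} (d : measure_display) (T : measurableType d)
  (P : probability T R) (n D : nat) (Y : T -> 'I_n -> 'I_n -> R) (x : T -> R)
  : \bar R :=
  ereal_inf [set e | exists c : monomial n D -> R,
     e = (\int[P]_(t in setT) ((poly_eval c (Y t) - x t) ^+ 2)%:E)%E].

(* Index type of the independent primitive variables: v_i, and W_ij for i <= j. *)
Definition pidx (n : nat) := ('I_n + {p : 'I_n * 'I_n | (p.1 <= p.2)%N})%type.

Definition mutually_independent {R : realType} (d : measure_display)
  (T : measurableType d) (P : probability T R) (K : finType) (X : K -> T -> R) :=
  forall B : K -> set R, (forall k, measurable (B k)) ->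
    P (\bigcap_(k in [set: K]) (X k @^-1` B k)) =
    (\prod_(k : K) P (X k @^-1` B k))%E.

Definition planted_submatrix_model {R : realType} (d : measure_display)
  (T : measurableType d) (P : probability T R) (n : nat) (rho : R)
  (v : 'I_n -> {RV P >-> R}) (W : 'I_n -> 'I_n -> {RV P >-> R}) : Prop :=
  (forall i t, v i t = 0 \/ v i t = 1) /\
      (forall i, P (v i @^-1` [set 1]) = rho%:E) /\
      (forall i j t, W i j t = W j i t) /\
      (forall i j : 'I_n, (i < j)%N -> forall A : set R, measurable A ->
          P (W i j @^-1` A) = normal_prob 0 1 A) /\
      (forall (i : 'I_n) (A : set R), measurable A ->
          P (W i i @^-1` A) = normal_prob 0 (Num.sqrt 2) A) /\
      mutually_independent P
        (fun k : pidx n => match k with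
                           | inl i => (v i : T -> R)
                           | inr p => (W (sval p).1 (sval p).2 : T -> R)
                           end).

Definition observation {R : realType} (d : measure_display) (T : measurableType d)
  (P : probability T R) (n : nat) (lambda : R)
  (v : 'I_n -> {RV P >-> R}) (W : 'I_n -> 'I_n -> {RV P >-> R})
  : T -> 'I_n -> 'I_n -> R :=
  fun t i j => lambda * v i t * v j t + W i j t.

(* Main.v *)
Require Import Defs.
From HB Require Import structures.
From mathcomp Require Import all_boot all_order all_algebra.
From mathcomp Require Import all_classical all_reals all_analysis.
From mathcomp Require Import measurable_realfun.
From mathcomp Require Import ring lra zify.
Import Order.TTheory GRing.Theory Num.Theory.
Import numFieldNormedType.Exports.
Set Implicit Arguments. Unset Strict Implicit. Unset Printing Implicit Defensive.
Local Open Scope classical_set_scope.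
Local Open Scope ring_scope.

(** Lower bound.  Suppose a function G of the noise alone satisfies
    E (f(Y) G) = E (f(Y) x) for every polynomial f of degree at most D.  Then
    E (f(Y) - x)^2 = E (f(Y) - G)^2 + E x^2 - E G^2 >= rho - E G^2.
    Writing Y = X + Z after normalising the noise, such a G is the sum of
    kappa_a / a! H_a(Z) over multi-indices a of degree at most D, where H_a are
    the Hermite polynomials and kappa_a is the joint cumulant of x and of the
    entries of X listed by a.  See a as a multigraph on the n vertices.  Then
    kappa_a vanishes unless a can be grown edge by edge from the root, and is at
    most lambda^|a| rho^|V(a)| (|a|+1)^|a|, so that summing along the growth
    gives E G^2 <= rho^2 sum_k (k+1) r^(2k).

    Upper bound.  Apply a polynomial of degree D that is flat at 0 and at 1 to
    an unbiased linear statistic: Y_11 / lambda, or the normalised sum of the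
    off-diagonal entries of the first row.  The moments of order at most 2D of
    the error of the statistic are read off its exponential moments. *)

(** * Independence and normal laws *)

(** Tested on f(Y) = H_a(Y), the dual identity becomes a linear system for kappa: by the addition
    formula H_a(X + Z) = sum_b C(a,b) X^(a-b) H_b(Z) and by orthogonality, it reads sum_b C(a,b) E
    X^(a-b) kappa_b = E (x X^a). This is the recursion of joint cumulants, triangular with ones on
    the diagonal, and it serves as their definition throughout. Since v is 0/1, each moment is a
    product of edge weights times rho to the number of distinct vertices. The factor D(D+1) has two
    sources at degree k: (k+1)^k from the bound on a cumulant, and k^k, the square root of the
    growth of the number of multigraphs. That number also carries max(1, n rho^2)^k, which is where
    the minimum in the hypothesis comes from. In the upper bound the two statistics answer to the
    two values of the minimum. Flatness of the polynomial turns a small error xi of the statistic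
    into one of order xi^(k+1), with D = 2k+1, at the cost of a factor 64^k in the mean square.
    Hence the moments of order 2m of xi are held to (r^2/64)^m up to a constant, and the logarithms
    enter through L >= 5D. *)

Section weighted.
Import HBNNSimple.
(** Simple functions and monotone convergence extend the hypothesis from indicators to [phi]. The
    weight [g] lets the lemma serve in three ways: as the product of the other independent factors,
    as the normal density with [X] the identity, and as the constant 1 for an image law. *)
Lemma ge0_integral_weighted d d' (T : measurableType d) (T' : measurableType d')
  (R : realType) (mu : {measure set T -> \bar R}) (nu : {measure set T' -> \bar R})
  (X : T -> T') (g : T -> R) :
  measurable_fun setT X -> measurable_fun setT g -> (forall t, 0 <= g t) ->
  (forall B, measurable B -> (\int[mu]_t (g t * \1_B (X t))%:E = nu B)%E) ->
  forall phi : T' -> R, measurable_fun setT phi -> (forall x, 0 <= phi x) ->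
  (\int[mu]_t (g t * phi (X t))%:E = \int[nu]_x (phi x)%:E)%E.
Proof.
move=> mX mg g0 gX phi mphi phi0.
have mE : measurable_fun [set: T'] (EFin \o phi) by exact/measurable_EFinP.
pose f_ := nnsfun_approx (@measurableT _ T') mE.
have fcvg x : (f_ n x)%:E @[n --> \oo] --> (phi x)%:E.
  by apply: (cvg_nnsfun_approx) => // y _; rewrite lee_fin.
transitivity (limn (fun n => \int[mu]_t (g t * f_ n (X t))%:E)%E).
  rewrite -monotone_convergence//.
  - apply: eq_integral => t _; apply/esym/cvg_lim => //.
    under eq_fun do rewrite EFinM.
    by rewrite EFinM; apply: cvgeZl.
  - move=> n; apply/measurable_EFinP/measurable_funM => //.
    by apply: measurableT_comp.
  - by move=> n t _; rewrite lee_fin mulr_ge0.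
  - move=> t _ m n mn; rewrite lee_fin ler_wpM2l//.
    exact/lefP/nd_nnsfun_approx.
transitivity (limn (fun n => \int[nu]_x (f_ n x)%:E)%E); last first.
  rewrite -monotone_convergence//.
  - by apply: eq_integral => t _; apply/cvg_lim.
  - by move=> n; exact/measurable_EFinP.
  - by move=> n t _; rewrite lee_fin.
  - move=> t _ m n mn; rewrite lee_fin.
    exact/lefP/nd_nnsfun_approx.
congr (limn _); apply/funext => n.
transitivity (\int[mu]_t (\sum_(k \in range (f_ n)) (k%:E * (g t * \1_(f_ n @^-1` [set k]) (X t))%:E)))%E.
  apply: eq_integral => t _.
  rewrite [in LHS](fimfunE (f_ n)).
  rewrite EFinM -fsumEFin// ge0_mule_fsumr//; last first.
    by move=> k; apply: nnfun_muleindic_ge0.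
  apply: eq_fsbigr => k _; rewrite -!EFinM; congr EFin.
  by rewrite mulrCA.
rewrite ge0_integral_fsum//; first last.
- move=> k t _; rewrite -EFinM mulrCA EFinM mule_ge0// ?lee_fin//.
  by apply: nnfun_muleindic_ge0.
- move=> k; apply/measurable_EFinP; apply: measurable_funM => //.
  apply: measurable_funM => //.
  by apply: measurableT_comp.
transitivity (\int[nu]_x (\sum_(k \in range (f_ n)) (k * \1_(f_ n @^-1` [set k]) x)%:E))%E; last first.
  by apply: eq_integral => t _; rewrite [in RHS](fimfunE (f_ n)) fsumEFin.
rewrite ge0_integral_fsum//; first last.
- move=> k t _; exact: nnfun_muleindic_ge0.
- move=> k; apply/measurable_EFinP; exact: measurable_funM.
apply: eq_fsbigr => r rfn.
have r0 : 0 <= r by move: rfn; rewrite inE => -[x _ <-].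
rewrite ge0_integralZl//; first last.
- by move=> t _; rewrite lee_fin mulr_ge0.
- apply/measurable_EFinP; apply: measurable_funM => //.
  by apply: measurableT_comp.
rewrite gX//.
under eq_integral do rewrite EFinM.
rewrite ge0_integralZl//; last by apply/measurable_EFinP.
by rewrite integral_indic// setIT.
Qed.
End weighted.

Section independence.
Context d (T : measurableType d) (R : realType) (P : probability T R).
Variables (K : finType) (X : K -> T -> R).
Hypothesis mX : forall k, measurable_fun [set: T] (X k).
Hypothesis iX : mutually_independent P X.

(** Independence is given for events only, that is, for indicators. The list [s] holds the
    coordinates whose factor is arbitrary; the induction frees them one at a time, the remaining
    factors acting as a weight. *)
Lemma ge0_integral_indep_prod (phi : K -> R -> R) (e : K -> R) :
  (forall k, measurable_fun [set: R] (phi k)) -> (forall k x, 0 <= phi k x) ->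
  (forall k, (\int[P]_t (phi k (X k t))%:E = (e k)%:E)%E) ->
  (\int[P]_t (\prod_k phi k (X k t))%:E = (\prod_k e k)%:E)%E.
Proof.
move=> mphi phi0 ephi.
suff H (s : seq K) : uniq s -> forall (phi : K -> R -> R) (e : K -> R),
    (forall k, measurable_fun [set: R] (phi k)) -> (forall k x, 0 <= phi k x) ->
    (forall k, (\int[P]_t (phi k (X k t))%:E = (e k)%:E)%E) ->
    (forall k, k \notin s -> exists2 B, measurable B & phi k = \1_B) ->
    (\int[P]_t (\prod_k phi k (X k t))%:E = (\prod_k e k)%:E)%E.
  by apply: (H (enum K)) => // [|k]; rewrite ?enum_uniq// mem_enum.
elim: s => [|k0 s IH] /= us {}phi {}e {}mphi {}phi0 {}ephi phiB.
  have /choice[B hB] : forall k, exists B, measurable B /\ phi k = \1_B.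
    by move=> k; have [//|B mB eB] := phiB k; exists B.
  have mB k : measurable (X k @^-1` B k).
    by rewrite -[_ @^-1` _]setTI; apply: mX => //; have [] := hB k.
  have := iX (fun k => (hB k).1).
  have -> : (\prod_k e k)%:E = (\prod_k P (X k @^-1` B k))%E.
    rewrite -prodEFin; apply: eq_bigr => k _; rewrite -ephi.
    under eq_integral do rewrite (hB k).2.
    by rewrite (integral_indic _ _ (mB k)) ?setIT.
  move=> <-.
  have mI : measurable (\bigcap_(k in [set: K]) (X k @^-1` B k)).
    by apply: fin_bigcap_measurable => //; exact: finite_finset.
  rewrite -[in RHS](setIT (\bigcap_(_ in _) _)) -(integral_indic _ _ mI)//.
  apply: eq_integral => t _; congr EFin.
  rewrite indicE; have [/set_mem ht|/negP ht] := boolP (t \in _).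
    rewrite big1// => k _; rewrite (hB k).2 indicE mem_set//.
    exact: ht.
  have [k hk] : exists k, X k t \notin B k.
    apply: contrapT => hn; apply: ht; apply/mem_set => k _.
    by apply: contrapT => hk; apply: hn; exists k; apply/negP => /set_mem.
  by rewrite (bigD1 k)//= (hB k).2 indicE (negbTE hk) mul0r.
move: us => /andP[k0s us].
have e0 k : 0 <= e k.
  by rewrite -lee_fin -ephi; apply: integral_ge0 => t _; rewrite lee_fin.
have c0 : 0 <= \prod_(k | k != k0) e k by apply: prodr_ge0.
pose X0 : {RV P >-> R} := HB.pack (X k0) (isMeasurableFun.Build _ _ _ _ _ (mX k0)).
(* Under the weight, [X k0] keeps its own law up to the product of the other means; the induction
   hypothesis is exactly this statement on indicators. *)
pose nu := mscale (NngNum c0) (distribution P X0).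
have := @ge0_integral_weighted _ _ T R R P nu (X k0)
  (fun t => \prod_(k | k != k0) phi k (X k t)) (mX k0).
have mg : measurable_fun [set: T] (fun t => \prod_(k | k != k0) phi k (X k t)).
  under eq_fun do rewrite big_mkcond /=.
  by apply: measurable_prod => k _; case: (k != k0) => //; exact: (measurableT_comp (mphi k) (mX k)).
move=> /(_ mg) H.
under eq_integral do rewrite (bigD1 k0)//= mulrC.
rewrite H//; last 2 first.
- by move=> t; apply: prodr_ge0.
- move=> B mB.
  pose phi' k := if k == k0 then \1_B else phi k.
  have mB0 : measurable (X k0 @^-1` B) by rewrite -[_ @^-1` _]setTI; apply: mX.
  pose e' k := if k == k0 then fine (P (X k0 @^-1` B)) else e k.
  transitivity (\int[P]_t (\prod_k phi' k (X k t))%:E)%E.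
    apply: eq_integral => t _; rewrite [in RHS](bigD1 k0)//= {1}/phi' eqxx mulrC.
    by congr (_ * _)%:E; apply: eq_bigr => k /negbTE kk0; rewrite /phi' kk0.
  rewrite (IH us phi' e') /phi' /e' //.
  + rewrite (bigD1 k0)//= eqxx mulrC EFinM fineK ?fin_num_measure//.
    rewrite /nu /mscale/=; congr (_%:E * _)%E.
    by apply: eq_bigr => k /negbTE ->.
  + by move=> k; case: ifP.
  + by move=> k x; case: ifP.
  + move=> k; case: eqP => [->|//].
    by rewrite (integral_indic _ _ mB0) ?setIT// fineK// fin_num_measure.
  + move=> k ks; case: eqP => [kk0|/eqP kk0]; first by exists B.
    by apply: phiB; rewrite inE negb_or kk0.
rewrite /nu (@ge0_integral_mscale _ _ _ (distribution P X0)) //; first last.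
- by move=> x _; rewrite lee_fin.
- exact/measurable_EFinP.
rewrite ge0_integral_distribution//; first last.
- by move=> x; rewrite lee_fin.
- exact/measurable_EFinP.
by rewrite [X in (_ * X)%E](ephi k0) /= -EFinM [in RHS](bigD1 k0)//= [in RHS]mulrC.
Qed.

(** Each factor is split into positive and negative parts, and the product is expanded over all
    choices [s] of sign. *)
Lemma integral_indep_prod (phi : K -> R -> R) :
  (forall k, measurable_fun [set: R] (phi k)) ->
  (forall k, P.-integrable [set: T] (fun t => (phi k (X k t))%:E)) ->
  P.-integrable [set: T] (fun t => (\prod_k phi k (X k t))%:E) /\
  (\int[P]_t \prod_k phi k (X k t) = \prod_k \int[P]_t phi k (X k t))%R.
Proof.
move=> mphi iphi.
pose sg (b : bool) : R := if b then 1 else -1.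
pose psi (b : bool) (k : K) : R -> R := if b then (phi k)^\+ else (phi k)^\-.
have psiE k x : phi k x = \sum_b sg b * psi b k x.
  rewrite big_bool /= mul1r mulN1r.
  by rewrite -[in LHS](funrposBneg (phi k)).
have mpsi b k : measurable_fun [set: R] (psi b k).
  by rewrite /psi; case: b; [apply: measurable_funrpos|apply: measurable_funrneg].
have psi0 b k x : 0 <= psi b k x by rewrite /psi; case: b; [exact: funrpos_ge0|exact: funrneg_ge0].
have ipsi b k : P.-integrable [set: T] (fun t => (psi b k (X k t))%:E).
  case: b.
    exact: (@integrable_funrpos _ _ _ P setT (fun t => phi k (X k t)) measurableT (iphi k)).
  exact: (@integrable_funrneg _ _ _ P setT (fun t => phi k (X k t)) measurableT (iphi k)).
pose e b k := (\int[P]_t psi b k (X k t))%R.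
have eE b k : (\int[P]_t (psi b k (X k t))%:E = (e b k)%:E)%E.
  by rewrite /e /Rintegral fineK//; apply: integrable_fin_num.
have prodE t : \prod_k phi k (X k t) =
    \sum_(s : {ffun K -> bool}) (\prod_k sg (s k)) * \prod_k psi (s k) k (X k t).
  under eq_bigr do rewrite psiE.
  rewrite bigA_distr_bigA; apply: eq_bigr => s _.
  by rewrite big_split.
have iprod (s : {ffun K -> bool}) :
    P.-integrable [set: T] (fun t => (\prod_k psi (s k) k (X k t))%:E) /\
    (\int[P]_t (\prod_k psi (s k) k (X k t))%:E = (\prod_k e (s k) k)%:E)%E.
  have h := @ge0_integral_indep_prod (fun k => psi (s k) k) (fun k => e (s k) k)
    (fun k => mpsi _ _) (fun k => psi0 _ _) (fun k => eE _ _).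
  split=> //; apply/integrableP; split.
    apply/measurable_EFinP; apply: measurable_prod => k _.
    by apply: measurableT_comp.
  under eq_integral do rewrite gee0_abs ?lee_fin ?prodr_ge0//.
  by rewrite h ltry.
have isum : P.-integrable [set: T] (fun t => \sum_(s : {ffun K -> bool})
    ((\prod_k sg (s k))%:E * (\prod_k psi (s k) k (X k t))%:E)%E).
  apply: integrable_sum => // s _.
  by apply: integrableZl => //; exact: (iprod s).1.
split.
  apply: eq_integrable isum => // t _.
  by rewrite prodE -sumEFin; apply: eq_bigr => s _; rewrite EFinM.
rewrite /Rintegral.
under eq_integral do (rewrite prodE -sumEFin; under eq_bigr do rewrite EFinM).
rewrite integral_sum//; last first.
  by move=> s; apply: integrableZl => //; exact: (iprod s).1.
rewrite (eq_bigr (fun s : {ffun K -> bool} => (\prod_k sg (s k) * \prod_k e (s k) k)%:E)); last first.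
  by move=> s _; rewrite EFinM -(iprod s).2 -integralZl// (iprod s).1.
rewrite sumEFin /=.
under [RHS]eq_bigr => k _.
  have -> : fine (\int[P]_t (phi k (X k t))%:E)%E = \sum_b sg b * e b k.
    under eq_integral do rewrite psiE big_bool /= mul1r mulN1r EFinB.
    rewrite integralB//; [|exact: (ipsi true)|exact: (ipsi false)].
    by rewrite (eE true) (eE false) /= big_bool /= mul1r mulN1r.
  over.
rewrite bigA_distr_bigA; apply: eq_bigr => s _.
by rewrite big_split.
Qed.
End independence.

Section weighted_signed.
Context d d' (T : measurableType d) (T' : measurableType d') (R : realType).
Variables (mu : {measure set T -> \bar R}) (nu : {measure set T' -> \bar R}).
Variables (X : T -> T') (g : T -> R).
Hypotheses (mX : measurable_fun [set: T] X) (mg : measurable_fun [set: T] g)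
  (g0 : forall t, 0 <= g t)
  (gX : forall B, measurable B -> (\int[mu]_t (g t * \1_B (X t))%:E = nu B)%E).

Lemma integrable_weighted (phi : T' -> R) : measurable_fun [set: T'] phi ->
  nu.-integrable [set: T'] (EFin \o phi) <->
  mu.-integrable [set: T] (fun t => (g t * phi (X t))%:E).
Proof.
move=> mphi.
have mgX : measurable_fun [set: T] (fun t => (g t * phi (X t))%:E).
  by apply/measurable_EFinP/measurable_funM => //; apply: measurableT_comp.
have E : (\int[mu]_t `|(g t * phi (X t))%:E| = \int[nu]_x `|(phi x)%:E|)%E.
  rewrite -(@ge0_integral_weighted _ _ _ _ _ mu nu X g mX mg g0 gX (fun x => `|phi x|)) //.
  - by apply: eq_integral => t _; rewrite abse_EFin normrM ger0_norm.
  - exact: measurableT_comp.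
split=> /integrableP[m f]; apply/integrableP; split => //.
- by rewrite E.
- exact/measurable_EFinP.
- by rewrite -E.
Qed.

Lemma integral_weighted (phi : T' -> R) : measurable_fun [set: T'] phi ->
  nu.-integrable [set: T'] (EFin \o phi) ->
  (\int[mu]_t (g t * phi (X t))%:E = \int[nu]_x (phi x)%:E)%E.
Proof.
move=> mphi iphi.
have ip := integrable_funrpos measurableT iphi.
have im := integrable_funrneg measurableT iphi.
have mp := measurable_funrpos mphi.
have mm := measurable_funrneg mphi.
transitivity (\int[nu]_x ((EFin \o (phi^\+)%R) x - (EFin \o (phi^\-)%R) x))%E; last first.
  by apply: eq_integral => x _; rewrite -[in RHS](funrposBneg phi) /= EFinB.
rewrite integralB//=.
rewrite -!(@ge0_integral_weighted _ _ _ _ _ mu nu X g mX mg g0 gX) //.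
rewrite -integralB//; first last.
- exact/(integrable_weighted mm).
- exact/(integrable_weighted mp).
apply: eq_integral => t _ /=.
by rewrite -[in LHS](funrposBneg phi) -EFinB -mulrBr.
Qed.
End weighted_signed.

(** * Exponential moments and moment recursion of the centred normal law *)

Section normal_law.
Context (R : realType).
Local Notation mu := (@lebesgue_measure R).
Variable (s : R).
Hypothesis s0 : s != 0.
Local Notation pdf := (normal_pdf 0 s).

Lemma normal_density B : measurable B ->
  (\int[mu]_x (pdf x * \1_B (id x))%:E = normal_prob 0 s B)%E.
Proof.
move=> mB; rewrite /normal_prob [in RHS]integral_mkcond.
apply: eq_integral => x _; rewrite EFinM patchE indicE.
by case: ifP => _; rewrite ?mule1 ?mule0.
Qed.

(** Completing the square gives a constant times the density of mean [a * s ^+ 2]. *)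
Lemma normal_mgf a : (\int[mu]_x (pdf x * expR (a * x))%:E = (expR (a ^+ 2 * s ^+ 2 / 2))%:E)%E.
Proof.
transitivity (\int[mu]_x ((expR (a ^+ 2 * s ^+ 2 / 2))%:E * (normal_pdf (a * s ^+ 2) s x)%:E))%E.
  apply: eq_integral => x _; rewrite -EFinM !normal_pdfE//=.
  congr EFin; rewrite [LHS]/= -[LHS]mulrA [RHS]mulrCA; congr (_ * _).
  rewrite /normal_fun -!expRD; congr expR.
  by field.
rewrite integralZl//; last exact: integrable_normal_pdf.
by rewrite integral_normal_pdf mule1.
Qed.

Lemma exprn_le_expR (k : nat) (x : R) : 0 <= x -> x ^+ k <= k`!%:R * expR x.
Proof.
move=> x0; case: k => [|k].
  rewrite expr0 fact0 mul1r; apply: le_trans (expR_ge1Dx x); lra.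
have := expR_ge1Dxn k x0.
have f0 : 0 < (k.+1)`!%:R :> R by rewrite ltr0n fact_gt0.
rewrite -(ler_pM2l f0) mulrDr mulr1 mulrCA mulfV ?gt_eqF// mulr1 => /(le_trans _); apply.
by rewrite lerDr ltW.
Qed.

Lemma normr_exprn_le (k : nat) (x : R) :
  `|x| ^+ k <= k`!%:R * (expR (1 * x) + expR (-1 * x)).
Proof.
apply: (le_trans (exprn_le_expR _ (normr_ge0 _))).
rewrite ler_wpM2l//; case: (ger0P x) => _; rewrite mul1r mulN1r.
- by rewrite lerDl expR_ge0.
- by rewrite lerDr expR_ge0.
Qed.

Lemma normal_moment_integrable k : mu.-integrable [set: R] (fun x => (pdf x * x ^+ k)%:E).
Proof.
have mp : measurable_fun [set: R] pdf by exact: measurable_normal_pdf.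
have iexp a : mu.-integrable [set: R] (fun x => (pdf x * expR (a * x))%:E).
  apply/integrableP; split.
    apply/measurable_EFinP; apply: measurable_funM => //.
    by apply: measurableT_comp => //; apply: measurable_funM.
  under eq_integral do rewrite gee0_abs ?lee_fin ?mulr_ge0 ?normal_pdf_ge0 ?expR_ge0//.
  by rewrite normal_mgf ltry.
have ib : mu.-integrable [set: R] (fun x => (k`!%:R)%:E * ((pdf x * expR (1 * x))%:E + (pdf x * expR (-1 * x))%:E))%E.
  apply: integrableZl => //; apply: integrableD => //; exact: iexp.
apply: le_integrable ib => //.
  by apply/measurable_EFinP; apply: measurable_funM => //; exact: exprn_measurable.
move=> x _; rewrite -EFinD -EFinM !abse_EFin lee_fin -mulrDr mulrCA !normrM ler_wpM2l//.
rewrite normrX; apply: (le_trans (normr_exprn_le _ _)).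
by apply: ler_pM => //; rewrite ?ler_norm// addr_ge0// expR_ge0.
Qed.

Let F k (x : R) := x ^+ k * pdf x.
Let h k (x : R) := pdf x * (k%:R * x ^+ k.-1 - s ^- 2 * x ^+ k.+1).

Let dF k (x : R) : is_derive x 1 (F k) (h k x).
Proof.
pose c : R := - (2 * s ^+ 2)^-1; pose q : {poly R} := c *: 'X^2.
pose p : {poly R} := normal_peak s *: 'X^k.
have -> : F k = (fun y => p.[y]) * (expR \o (fun y => q.[y])).
  apply/funext => y; rewrite /F normal_pdfE// /normal_fun /= /p /q.
  rewrite [RHS]/(_ * _) /= !(hornerZ, hornerXn) mulrCA mulrA; congr (_ * expR _).
  by rewrite subr0 /c; field.
have H := is_deriveM (is_derive_poly p x)
  (is_derive1_comp (is_derive_expR q.[x]) (is_derive_poly q x)).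
apply: (is_derive_eq H).
rewrite /GRing.scale /= /h normal_pdfE// /normal_fun /p /q !derivZ !derivXn.
rewrite !(hornerZ, hornerXn, hornerMn) /=.
have -> : c * x ^+ 2 = - (x - 0) ^+ 2 / (s ^+ 2 *+ 2).
  by rewrite subr0 /c; field.
by rewrite /= /c [x ^+ k.+1]exprS -[x ^+ k.-1 *+ k]mulr_natl -[x ^+ 1 *+ 2]mulr_natl; field.
Qed.

Let ih k : mu.-integrable [set: R] (EFin \o h k).
Proof.
have i1 := integrableZl measurableT k%:R (normal_moment_integrable k.-1).
have i2 := integrableZl measurableT (s ^- 2) (normal_moment_integrable k.+1).
apply: eq_integrable (integrableB measurableT i1 i2) => // x _ /=.
by rewrite -!EFinM -EFinB /h mulrBr ![pdf x * (_ * _)]mulrCA.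
Qed.

(** Apply y^(k+1) <= (k+1)! e^y at y = x^2 / (2 s^2); the condition 1 <= |x| lets x^(2(k+1))
    dominate |x|^(k+1). *)
Let F_bound k : exists2 C : R, 0 <= C & forall x, 1 <= `|x| -> `|F k x| <= C / `|x|.
Proof.
have ps := normal_peak_gt0 s0.
have s2 : 0 < 2 * s ^+ 2 by rewrite mulr_gt0// exprn_even_gt0.
exists (normal_peak s * ((k.+1)`!%:R * (2 * s ^+ 2) ^+ k.+1)).
  by rewrite mulr_ge0 ?ltW// mulr_gt0// ?ltr0n ?fact_gt0// exprn_gt0.
move=> x x1; have x0 : 0 < `|x| by apply: lt_le_trans x1.
rewrite ler_pdivlMr// /F normal_pdfE// normrM normrX [`|_ * normal_fun _ _ _|]ger0_norm; last first.
  by rewrite mulr_ge0 ?normal_peak_ge0 ?expR_ge0.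
rewrite mulrCA -mulrA (ler_wpM2l (ltW ps))// mulrC mulrA -exprS.
have := @exprn_le_expR k.+1 (x ^+ 2 / (2 * s ^+ 2)) (divr_ge0 (sqr_ge0 _) (ltW s2)).
rewrite expr_div_n ler_pdivrMr ?exprn_gt0// => H.
have -> : normal_fun 0 s x = (expR (x ^+ 2 / (2 * s ^+ 2)))^-1.
  by rewrite /normal_fun subr0 -expRN; congr expR; field.
rewrite ler_pdivrMr ?expR_gt0// mulrAC; apply: le_trans H.
rewrite -(real_normK (num_real x)) -exprM; apply: ler_weXn2l => //.
by rewrite mul2n -addnn leq_addr.
Qed.

(** Integration by parts: [h k] is the derivative of [F k], which vanishes at infinity, so its
    integral is 0. At k = 0 the truncated [k.-1] is multiplied by 0. *)
Lemma normal_moment_rec k :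
  (\int[mu]_x (pdf x * x ^+ k.+1) = k%:R * s ^+ 2 * \int[mu]_x (pdf x * x ^+ k.-1))%R.
Proof.
have [C C0 FC] := F_bound k.
(* The shift by one keeps the interval nondegenerate and its ends in the range of [F_bound]. *)
pose I n : set R := `[- n.+1%:R, n.+1%:R]%classic.
have mI n : measurable (I n) by exact: measurable_itv.
have FTC n : (\int[mu]_(x in I n) (h k x)%:E = (F k n.+1%:R)%:E - (F k (- n.+1%:R))%:E)%E.
  have dF1 x : derivable (F k) x 1 by case: (dF k x).
  have cF : continuous (F k).
    by move=> x; apply/differentiable_continuous/derivable1_diffP.
  apply: continuous_FTC2.
  - by rewrite gtrN// ltr0n.
  - apply: continuous_subspaceT => x; rewrite /h.
    apply: cvgM; first exact: continuous_normal_pdf.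
    have cp : continuous (fun y : R => k%:R * y ^+ k.-1 - s ^- 2 * y ^+ k.+1).
      have -> : (fun y : R => k%:R * y ^+ k.-1 - s ^- 2 * y ^+ k.+1) =
          horner (k%:R *: 'X^(k.-1) - (s ^- 2) *: 'X^(k.+1)).
        by apply/funext => y; rewrite !(hornerZ, hornerXn, hornerD, hornerN).
      exact: continuous_horner.
    exact: cp.
  - split=> //.
      by apply: cvg_at_right_filter; exact: cF.
    by apply: cvg_at_left_filter; exact: cF.
  - by move=> x _; rewrite derive1E; case: (dF k x).
have cvg1 : (fun n => \int[mu]_(x in I n) (h k x)%:E)%E @ \oo --> (\int[mu]_x (h k x)%:E)%E.
  pose f_ n := (EFin \o h k) \_ (I n).
  have [|||||_ _] := @dominated_convergence _ _ _ mu setT measurableT f_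
    (EFin \o h k) (fun x => `|(h k x)%:E|%E).
  - move=> n; apply/(measurable_restrictT _ (mI n)).
    by apply: measurable_funTS; exact: measurable_int (ih k).
  - exact: measurable_int (ih k).
  - apply: aeW => x _; apply: cvg_near_cst; near=> n.
    rewrite /f_ patchE mem_set// /I /= in_itv /= -ler_norml.
    apply: (@le_trans _ _ n%:R); last by rewrite ler_nat.
    by near: n; exact: nbhs_infty_ger.
  - exact: integrable_abse (ih k).
  - apply: aeW => x n _; rewrite /f_ patchE; case: ifP => // _.
    by rewrite abse0.
  move=> H; rewrite (_ : (fun n => _) = (fun n => \int[mu]_x f_ n x)%E)//.
  by apply/funext => n; rewrite integral_mkcond.
have cvg0 : (fun n => (F k n.+1%:R)%:E - (F k (- n.+1%:R))%:E)%E @ \oo --> (0:R)%:E.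
  under eq_fun do rewrite -EFinB.
  apply: cvg_EFin; first exact: nearW.
  have c0 : (fun n => 2 * C * (n.+1%:R^-1)) @ \oo --> (0 : R).
    rewrite -[X in _ --> X](mulr0 (2 * C)); apply: cvgMr.
    exact: cvg_harmonic.
  apply/norm_cvg0P; apply: (@squeeze_cvgr _ _ _ _ (cst 0) (fun n => 2 * C * (n.+1%:R^-1))).
  - near=> n; rewrite normr_ge0/=.
    apply: (le_trans (ler_normB _ _)).
    have h1 : 1 <= `|n.+1%:R : R| by rewrite ger0_norm// ler1n.
    have h2 : 1 <= `|- n.+1%:R : R| by rewrite normrN.
    have := lerD (FC _ h1) (FC _ h2).
    move=> /le_trans; apply.
    by rewrite normrN ger0_norm// -mulrDl -mulr2n -[C *+ 2]mulr_natl.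
  - exact: cvg_cst.
  - exact: c0.
have I0 : (\int[mu]_x (h k x)%:E = 0)%E.
  have E := funext FTC; rewrite E in cvg1.
  exact: (cvg_unique _ cvg1 cvg0).
have i1 := normal_moment_integrable k.-1.
have i2 := normal_moment_integrable k.+1.
have := I0.
have -> : (\int[mu]_x (h k x)%:E =
   k%:R%:E * \int[mu]_x (pdf x * x ^+ k.-1)%:E - (s ^- 2)%:E * \int[mu]_x (pdf x * x ^+ k.+1)%:E)%E.
  rewrite -!integralZl// -integralB//; [|exact: integrableZl|exact: integrableZl].
  apply: eq_integral => x _.
  by rewrite -!EFinM -EFinB /h mulrBr ![pdf x * (_ * _)]mulrCA.
rewrite /Rintegral.
rewrite -(fineK (integrable_fin_num measurableT i1)) -(fineK (integrable_fin_num measurableT i2)).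
rewrite -!EFinM -EFinB => -[] /eqP; rewrite subr_eq0 /= => /eqP H.
by rewrite mulrAC H mulrAC mulVf ?mul1r// expf_neq0.
Unshelve. all: by end_near. Qed.
End normal_law.

(** * Hermite polynomials and Gaussian moments *)

Section hermite.
Context {R : realFieldType}.

(** The monic (probabilists') Hermite polynomials. The recursion through the derivative is the form
    on which Stein's identity acts. *)
Fixpoint hermite (k : nat) : {poly R} :=
  if k is k'.+1 then 'X * hermite k' - (hermite k')^`() else 1.

Lemma deriv_hermite k : (hermite k)^`() = k%:R *: hermite k.-1.
Proof.
elim: k => [|k IH]; first by rewrite /= derivC scale0r.
rewrite /= derivB derivM derivX mul1r IH derivZ -scalerAr.
case: k IH => [|k] IH; first by rewrite !scale0r subr0 addr0 scale1r.
rewrite /= -addrA -scalerBr -/(hermite k.+1).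
by rewrite -[X in X + _]scale1r -scalerDl -[k.+2]add1n natrD.
Qed.

Lemma derivn_hermite k i : (hermite k)^`(i) = (k ^_ i)%:R *: hermite (k - i).
Proof.
elim: i => [|i IH]; first by rewrite ffactn0 scale1r subn0.
by rewrite derivnS IH derivZ deriv_hermite scalerA -natrM ffactnSr -subnS.
Qed.

Lemma nderivn_hermite k i : (hermite k)^`N(i) = 'C(k, i)%:R *: hermite (k - i).
Proof.
have f0 : i`!%:R != 0 :> R by rewrite pnatr_eq0 -lt0n fact_gt0.
apply: (scalerI f0); rewrite [LHS]scaler_nat -nderivn_def derivn_hermite.
by rewrite scalerA -natrM mulnC bin_ffact.
Qed.

Lemma size_hermite k : size (hermite k) = k.+1 /\ lead_coef (hermite k) = 1.
Proof.
elim: k => [|k [IH1 IH2]]; first by rewrite size_poly1 lead_coef1.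
have h0 : hermite k != 0 by rewrite -size_poly_gt0 IH1.
have s1 : size ('X * hermite k) = k.+2 by rewrite mulrC size_mulX// IH1.
have s2 : (size (- (hermite k)^`())%R < size ('X * hermite k)%R)%N.
  by rewrite size_polyN s1 ltnS -IH1 ltnW// lt_size_deriv.
rewrite /= size_polyDl// s1 lead_coefDl//; split=> //.
by rewrite mulrC lead_coefMX.
Qed.

Lemma hermite_span k (p : {poly R}) : (size p <= k.+1)%N ->
  exists a : nat -> R, p = \sum_(j < k.+1) a j *: hermite j.
Proof.
elim: k p => [|k IH] p sp.
  exists (fun _ => p`_0); rewrite big_ord1 /= alg_polyC.
  exact: size1_polyC.
pose q := p - p`_k.+1 *: hermite k.+1.
have [s1 l1] := size_hermite k.+1.
have sq : (size q <= k.+1)%N.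
  apply/leq_sizeP => j kj; rewrite coefB coefZ.
  have [->|jk] := eqVneq j k.+1.
    by move: l1; rewrite lead_coefE s1 -pred_Sn => ->; rewrite mulr1 subrr.
  have kj' : (k.+1 < j)%N by rewrite ltn_neqAle eq_sym jk.
  have e1 : (size p <= j)%N := leq_trans sp kj'.
  have e2 : (size (hermite k.+1) <= j)%N by rewrite s1.
  by rewrite (nth_default _ e1) (nth_default _ e2) mulr0 subr0.
have [a qa] := IH _ sq.
exists (fun j => if j == k.+1 then p`_k.+1 else a j).
rewrite big_ord_recr /= eqxx -[LHS](subrK (p`_k.+1 *: hermite k.+1)) -/q qa.
congr (_ + _); apply: eq_bigr => j _.
by rewrite ltn_eqF.
Qed.

Lemma hermite_exprn_span D k : (k <= D)%N ->
  exists a : nat -> R, (forall j, (k < j)%N -> a j = 0) /\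
   forall x, x ^+ k = \sum_(j < D.+1) a j * (hermite j).[x].
Proof.
move=> kD; have [|a ha] := @hermite_span k 'X^k; first by rewrite size_polyXn.
exists (fun j => if (j <= k)%N then a j else 0); split.
  by move=> j; rewrite ltnNge => /negbTE ->.
move=> x; rewrite -[LHS]hornerXn ha horner_sum.
rewrite (big_ord_widen_cond D.+1 xpredT (fun j => (a j *: hermite j).[x]))// big_mkcond.
apply: eq_bigr => j _; rewrite hornerZ ltnS /=.
by case: ifP => _; rewrite ?mul0r.
Qed.

(** Taylor expansion at z, the normalised derivatives of H_k being binomial multiples of lower H_j.
    The sum runs to the fixed bound [D], where binomials vanish beyond k, so that a product over
    edges expands over functions into ['I_D.+1]. *)
Lemma hermiteD D k (x z : R) : (k <= D)%N ->
  (hermite k).[x + z] = \sum_(j < D.+1) 'C(k, j)%:R * x ^+ (k - j) * (hermite j).[z].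
Proof.
move=> kD; have [sh _] := size_hermite k.
rewrite addrC nderiv_taylor; last exact: mulrC.
rewrite sh (reindex_inj rev_ord_inj) /=.
rewrite (big_ord_widen_cond D.+1 xpredT (fun j => (hermite k)^`N(k.+1 - j.+1).[z] * x ^+ (k.+1 - j.+1)))//.
rewrite big_mkcond /=; apply: eq_bigr => j _.
rewrite ltnS; case: leqP => jk; last by rewrite bin_small ?mul0r.
by rewrite subSS nderivn_hermite hornerZ bin_sub// subKn// mulrAC.
Qed.
End hermite.

(** * Random variables with all moments; Gaussian variables *)

Section moments.
Context d (T : measurableType d) (R : realType) (P : probability T R).
Implicit Types F G : T -> R.

Definition Ex F : R := (\int[P]_t F t)%R.

(** Unlike plain integrability, this is stable under products, so every integrability condition
    reduces to the primitive variables. *)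
Definition allmom F := measurable_fun [set: T] F /\
  forall k, P.-integrable [set: T] (fun t => (F t ^+ k)%:E).

Lemma allmom_int F : allmom F -> P.-integrable [set: T] (EFin \o F).
Proof. by case=> _ /(_ 1%N). Qed.

Lemma ExE F : allmom F -> (\int[P]_t (F t)%:E = (Ex F)%:E)%E.
Proof. by move=> mF; rewrite /Ex /Rintegral fineK//; apply: integrable_fin_num => //; exact: allmom_int. Qed.

Lemma allmom_cst c : allmom (fun=> c).
Proof.
split; first exact: measurable_cst.
by move=> k; apply: finite_measure_integrable_cst.
Qed.

Lemma Ex_cst c : Ex (fun=> c) = c.
Proof.
by rewrite /Ex Rintegral_cst// [X in fine X](probability_setT P) mulr1.
Qed.

Lemma allmom_le F G k : measurable_fun [set: T] F ->
  P.-integrable [set: T] (EFin \o G) -> (forall t, `|F t| ^+ k <= G t) ->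
  P.-integrable [set: T] (fun t => (F t ^+ k)%:E).
Proof.
move=> mF iG FG; apply: le_integrable iG => //.
  by apply/measurable_EFinP; exact: measurable_funX.
move=> t _; rewrite !abse_EFin lee_fin normrX.
by apply: (le_trans (FG t)); exact: ler_norm.
Qed.

Lemma allmomM F G : allmom F -> allmom G -> allmom (fun t => F t * G t).
Proof.
move=> [mF iF] [mG iG]; split; first exact: measurable_funM.
move=> k; apply: (@allmom_le _ (fun t => F t ^+ (2 * k) + G t ^+ (2 * k))).
- exact: measurable_funM.
- exact: (integrableD measurableT (iF (2 * k)%N) (iG (2 * k)%N)).
move=> t; rewrite normrM exprMn !exprM -[F t ^+ 2]real_normK ?num_real// -[G t ^+ 2]real_normK ?num_real//.
rewrite -!exprM mulnC !exprM.
have := sqr_ge0 (`|F t| ^+ k - `|G t| ^+ k).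
have a0 : 0 <= `|F t| ^+ k by rewrite exprn_ge0.
have b0 : 0 <= `|G t| ^+ k by rewrite exprn_ge0.
nra.
Qed.

Lemma exprD_le (a b : R) k : 0 <= a -> 0 <= b ->
  (a + b) ^+ k <= 2 ^+ k * (a ^+ k + b ^+ k).
Proof.
move=> a0 b0; wlog ab : a b a0 b0 / a <= b.
  move=> H; have [/H|/ltW/H] := leP a b; first exact.
  by rewrite addrC [X in _ * X]addrC; apply.
apply: (@le_trans _ _ ((2 * b) ^+ k)).
  by apply: lerXn2r; rewrite ?nnegrE ?addr_ge0 ?mulr_ge0//; lra.
by rewrite exprMn ler_wpM2l ?exprn_ge0// lerDr exprn_ge0.
Qed.

Lemma allmomD F G : allmom F -> allmom G -> allmom (fun t => F t + G t).
Proof.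
move=> [mF iF] [mG iG]; split; first exact: measurable_funD.
have iN (H : T -> R) : measurable_fun [set: T] H -> (forall k, P.-integrable [set: T] (fun t => (H t ^+ k)%:E)) ->
    forall k, P.-integrable [set: T] (fun t => (`|H t| ^+ k)%:E).
  move=> mH iH k; have := integrable_abse (iH k).
  by apply: eq_integrable => // t _ /=; rewrite normrX.
move=> k; apply: (@allmom_le _ (fun t => 2 ^+ k * (`|F t| ^+ k + `|G t| ^+ k))).
- exact: measurable_funD.
- have := integrableZl measurableT (2 ^+ k) (integrableD measurableT (iN _ mF iF k) (iN _ mG iG k)).
  by apply: eq_integrable => // t _; rewrite /= EFinM EFinD.
move=> t; apply: le_trans (exprD_le _ _ _) => //.
by apply: lerXn2r; rewrite ?nnegrE ?addr_ge0// ler_normD.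
Qed.

Lemma allmom_sum I (s : seq I) (Q : pred I) (F : I -> T -> R) :
  (forall i, allmom (F i)) -> allmom (fun t => \sum_(i <- s | Q i) F i t).
Proof.
move=> H; elim: s => [|i s IH].
  by under eq_fun do rewrite big_nil; exact: allmom_cst.
by under eq_fun do rewrite big_cons; case: (Q i) => //; exact: allmomD.
Qed.

Lemma allmom_prod I (s : seq I) (Q : pred I) (F : I -> T -> R) :
  (forall i, allmom (F i)) -> allmom (fun t => \prod_(i <- s | Q i) F i t).
Proof.
move=> H; elim: s => [|i s IH].
  by under eq_fun do rewrite big_nil; exact: allmom_cst.
by under eq_fun do rewrite big_cons; case: (Q i) => //; exact: allmomM.
Qed.

Lemma allmomX F k : allmom F -> allmom (fun t => F t ^+ k).
Proof.
move=> mF; elim: k => [|k IH]; first exact: allmom_cst.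
by under eq_fun do rewrite exprS; exact: allmomM.
Qed.

Lemma allmomZ c F : allmom F -> allmom (fun t => c * F t).
Proof. by move=> mF; apply: allmomM => //; exact: allmom_cst. Qed.

Lemma allmomB F G : allmom F -> allmom G -> allmom (fun t => F t - G t).
Proof.
move=> mF mG; under eq_fun do rewrite -mulN1r.
by apply: allmomD => //; exact: allmomZ.
Qed.

Lemma allmom_horner (p : {poly R}) F : allmom F -> allmom (fun t => p.[F t]).
Proof.
move=> mF; under eq_fun do rewrite horner_coef.
by apply: allmom_sum => i; apply: allmomZ; exact: allmomX.
Qed.

Lemma ExD F G : allmom F -> allmom G -> Ex (fun t => F t + G t) = Ex F + Ex G.
Proof. by move=> mF mG; rewrite /Ex RintegralD//; exact: allmom_int. Qed.

Lemma ExB F G : allmom F -> allmom G -> Ex (fun t => F t - G t) = Ex F - Ex G.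
Proof. by move=> mF mG; rewrite /Ex RintegralB//; exact: allmom_int. Qed.

Lemma ExZ c F : allmom F -> Ex (fun t => c * F t) = c * Ex F.
Proof. by move=> mF; rewrite /Ex RintegralZl//; exact: allmom_int. Qed.

Lemma Ex_sum I (s : seq I) (Q : pred I) (F : I -> T -> R) :
  (forall i, allmom (F i)) ->
  Ex (fun t => \sum_(i <- s | Q i) F i t) = \sum_(i <- s | Q i) Ex (F i).
Proof.
move=> H; elim: s => [|i s IH].
  by under eq_fun do rewrite big_nil; rewrite Ex_cst big_nil.
rewrite big_cons -IH; under eq_fun do rewrite big_cons.
by case: (Q i) => //; rewrite ExD//; exact: allmom_sum.
Qed.

Lemma Ex_ge0 F : (forall t, 0 <= F t) -> 0 <= Ex F.
Proof. by move=> F0; apply: Rintegral_ge0 => t _. Qed.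

Lemma le_Ex F G : allmom F -> allmom G -> (forall t, F t <= G t) -> Ex F <= Ex G.
Proof. by move=> mF mG FG; apply: le_Rintegral => //; exact: allmom_int. Qed.

Section gaussian.
Variables (W : T -> R) (s : R).
Hypothesis s0 : s != 0.
Hypothesis mW : measurable_fun [set: T] W.
Hypothesis hW : forall A : set R, measurable A -> P (W @^-1` A) = normal_prob 0 s A.
Local Notation mu := (@lebesgue_measure R).

Let g1 : T -> R := fun=> 1.
Let mg1 : measurable_fun [set: T] g1. Proof. exact: measurable_cst. Qed.

Let g10 t : 0 <= g1 t. Proof. by []. Qed.

Let hW1 B : measurable B -> (\int[P]_t (g1 t * \1_B (W t))%:E = normal_prob 0 s B)%E.
Proof.
move=> mB; rewrite -hW//.
have mWB : measurable (W @^-1` B) by rewrite -[_ @^-1` _]setTI; exact: mW.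
rewrite -[in RHS](setIT (W @^-1` B)) -(integral_indic _ _ mWB)//.
by apply: eq_integral => t _; rewrite mul1r.
Qed.

Lemma gauss_ge0_integral (phi : R -> R) : measurable_fun [set: R] phi ->
  (forall x, 0 <= phi x) ->
  (\int[P]_t (phi (W t))%:E = \int[mu]_x (normal_pdf 0 s x * phi x)%:E)%E.
Proof.
move=> mphi phi0.
rewrite (@ge0_integral_weighted _ _ _ _ _ mu (normal_prob 0 s) id (normal_pdf 0 s)
  (@measurable_id _ _ setT) (measurable_normal_pdf 0 s) (normal_pdf_ge0 0 s) (@normal_density _ s) phi)//.
rewrite -(@ge0_integral_weighted _ _ _ _ _ P (normal_prob 0 s) W g1 mW mg1 g10 hW1 phi)//.
by apply: eq_integral => t _; rewrite mul1r.
Qed.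

Lemma gauss_moment k :
  P.-integrable [set: T] (fun t => (W t ^+ k)%:E) /\
  Ex (fun t => W t ^+ k) = (\int[mu]_x (normal_pdf 0 s x * x ^+ k))%R.
Proof.
have mX : measurable_fun [set: R] (fun x : R => x ^+ k) by exact: exprn_measurable.
have [_ iN] := @integrable_weighted _ _ _ _ _ mu (normal_prob 0 s) id (normal_pdf 0 s)
  (@measurable_id _ _ setT) (measurable_normal_pdf 0 s) (normal_pdf_ge0 0 s) (@normal_density _ s) _ mX.
have {}iN := iN (@normal_moment_integrable _ s s0 k).
have [iW _] := @integrable_weighted _ _ _ _ _ P (normal_prob 0 s) W g1 mW mg1 g10 hW1 _ mX.
have {}iW := iW iN; split.
  by apply: eq_integrable iW => // t _; rewrite mul1r.
rewrite /Ex /Rintegral.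
rewrite (@integral_weighted _ _ _ _ _ mu (normal_prob 0 s) id (normal_pdf 0 s)
  (@measurable_id _ _ setT) (measurable_normal_pdf 0 s) (normal_pdf_ge0 0 s) (@normal_density _ s) _ mX iN).
rewrite -(@integral_weighted _ _ _ _ _ P (normal_prob 0 s) W g1 mW mg1 g10 hW1 _ mX iN).
by congr fine; apply: eq_integral => t _; rewrite mul1r.
Qed.

Lemma gauss_mgf a : (\int[P]_t (expR (a * W t))%:E = (expR (a ^+ 2 * s ^+ 2 / 2))%:E)%E.
Proof.
rewrite -(normal_mgf s0) (@gauss_ge0_integral (fun x => expR (a * x)))//.
by apply: measurableT_comp => //; apply: measurable_funM.
Qed.

Lemma gauss_allmom : allmom W.
Proof. by split=> // k; exact: (gauss_moment k).1. Qed.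

Local Notation Z := (fun t => W t / s).

Lemma gauss_std_allmom : allmom Z.
Proof. by apply: allmomM; [exact: gauss_allmom|exact: allmom_cst]. Qed.

Lemma gauss_std_moment k : Ex (fun t => Z t ^+ k.+1) = k%:R * Ex (fun t => Z t ^+ k.-1).
Proof.
have ZE j : Ex (fun t => Z t ^+ j) = s ^- j * Ex (fun t => W t ^+ j).
  under eq_fun do rewrite exprMn exprVn mulrC.
  by rewrite ExZ//; apply: allmomX; exact: gauss_allmom.
rewrite !ZE (gauss_moment k.+1).2 (gauss_moment k.-1).2 normal_moment_rec//.
case: k => [|k]; first by rewrite !mul0r mulr0.
rewrite /= !exprS; field.
by rewrite expf_neq0.
Qed.

(** Both sides are linear in [p], and on a monomial the identity is the moment recursion. *)
Lemma gauss_stein (p : {poly R}) :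
  Ex (fun t => Z t * p.[Z t]) = Ex (fun t => p^`().[Z t]).
Proof.
have mZ := gauss_std_allmom.
have dp x : p^`().[x] = \sum_(i < size p) p`_i * (i%:R * x ^+ i.-1).
  have -> : p^`() = \sum_(i < size p) p`_i *: (i%:R *: 'X^(i.-1)).
    rewrite -{1}[p]coefK poly_def (big_morph (@deriv R) (@derivD R) (derivC 0)).
    by apply: eq_bigr => i _; rewrite derivZ derivXn scaler_nat.
  by rewrite horner_sum; apply: eq_bigr => i _; rewrite !hornerZ hornerXn.
under eq_fun do rewrite horner_coef mulr_sumr.
under [in RHS]eq_fun do rewrite dp.
rewrite !Ex_sum; first last.
- by move=> i; apply: allmomM => //; apply: allmomZ; exact: allmomX.
- by move=> i; apply: allmomZ; apply: allmomZ; exact: allmomX.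
apply: eq_bigr => i _.
under eq_fun do rewrite mulrCA -exprS.
by rewrite !ExZ ?gauss_std_moment//; [exact: allmomX|apply: allmomZ; exact: allmomX|exact: allmomX].
Qed.

(** With p = H_j H_k one has H_(j+1) H_k = Z p - p' + H_j H_k'. The first two terms cancel by Stein,
    and H_k' = k H_(k-1) lowers both indices by one. *)
Lemma gauss_hermite j k :
  Ex (fun t => (hermite j).[Z t] * (hermite k).[Z t]) = (j`!)%:R *+ (j == k).
Proof.
have mZ := gauss_std_allmom.
have mH i : allmom (fun t => (hermite i).[Z t]) by exact: allmom_horner.
elim: j k => [|j IH] k.
  under eq_fun do rewrite hornerC mul1r.
  case: k => [|k]; first by under eq_fun do rewrite hornerC; rewrite Ex_cst.
  under eq_fun do rewrite /= hornerD hornerN mulrC hornerMX mulrC.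
  rewrite ExB ?gauss_stein ?subrr//; last exact: allmom_horner.
  by apply: allmomM => //; exact: allmom_horner.
pose p : {poly R} := hermite j * hermite k.
have E t : (hermite j.+1).[Z t] * (hermite k).[Z t] =
    Z t * p.[Z t] - p^`().[Z t] + k%:R * ((hermite j).[Z t] * (hermite k.-1).[Z t]).
  rewrite /p derivM [(hermite k)^`()]deriv_hermite /=.
  by rewrite !(hornerD, hornerM, hornerZ, hornerN, hornerX); ring.
under eq_fun do rewrite E.
have a1 : allmom (fun t => Z t * p.[Z t]) by apply: allmomM => //; exact: allmom_horner.
have a2 : allmom (fun t => p^`().[Z t]) by exact: allmom_horner.
have a3 : allmom (fun t => (hermite j).[Z t] * (hermite k.-1).[Z t]) by exact: allmomM.
rewrite ExD; [|exact: allmomB|exact: allmomZ].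
rewrite ExB// ExZ// gauss_stein subrr add0r IH.
case: k {p E a1 a2 a3} => [|k]; first by rewrite mul0r.
rewrite /= eqSS; case: eqP => [->|]; last by rewrite mulr0.
by rewrite !mulr1n factS natrM.
Qed.
End gaussian.
End moments.

(** * Cumulants indexed by multigraphs *)

(* the set notations of this part are those of finite sets *)
Local Close Scope classical_set_scope.

Section multigraph.
Context {R : realFieldType} (U E : finType) (D : nat) (ends : E -> {set U}) (i0 : U).
Implicit Types (a b : {ffun E -> 'I_D.+1}) (e : E).

(** A multi-index gives each edge a multiplicity. Repeated 0/1 factors collapse, so the moments
    below need only the vertex set of a - b, and that of a together with the root. *)
Definition mgdeg a : nat := (\sum_e (a e : nat))%N.
Definition mgdiffV a b : {set U} := \bigcup_(e | (b e < a e)%N) ends e.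
Definition mgrootV a : {set U} := i0 |: \bigcup_(e | (0 < a e)%N) ends e.
Definition mgbin a b : nat := (\prod_e 'C(a e, b e))%N.
Definition mgle b a : bool := [forall e, b e <= a e]%N.

Lemma mgbin_neq0 a b : mgbin a b != 0%N -> mgle b a.
Proof.
move=> h; apply/forallP => e; rewrite leqNgt; apply/negP => lt.
by move: h; rewrite /mgbin (bigD1 e)//= bin_small.
Qed.

Lemma mgbinn a : mgbin a a = 1%N.
Proof. by rewrite /mgbin big1// => e _; rewrite binn. Qed.

Lemma mgle_deg b a : mgle b a -> (mgdeg b <= mgdeg a)%N.
Proof. by move=> /forallP h; apply: leq_sum => e _; exact: h. Qed.

Lemma mgle_deg_eq b a : mgle b a -> (mgdeg a <= mgdeg b)%N -> b = a.
Proof.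
move=> /forallP h dab; apply/ffunP => e; apply/val_inj/eqP => /=.
rewrite eqn_leq h leqNgt; apply/negP => lt; move: dab; apply/negP; rewrite -ltnNge.
rewrite /mgdeg (bigD1 e)//= [X in (_ < X)%N](bigD1 e)//= -addSn.
by apply: leq_add => //; apply: leq_sum.
Qed.

Lemma mgle_deg_lt b a : mgle b a -> b != a -> (mgdeg b < mgdeg a)%N.
Proof.
by move=> ba; apply: contraNltn => dab; apply/eqP/mgle_deg_eq.
Qed.

Section cumulants.
Variables (mu : E -> R) (rho lam : R).

(* the moments E X^(a-b) and E (x X^a) of the planted signal *)
Definition mgmom a b : R := (\prod_e mu e ^+ (a e - b e)) * rho ^+ #|mgdiffV a b|.
Definition mgrootmom a : R := (\prod_e mu e ^+ a e) * rho ^+ #|mgrootV a|.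

Lemma mgmomn a : mgmom a a = 1.
Proof.
rewrite /mgmom /mgdiffV big1 ?mul1r => [|e _]; last by rewrite subnn.
by rewrite big_pred0 ?cards0// => e; rewrite ltnn.
Qed.

(* the joint cumulants of x and of the entries of X, up to degree k *)
Definition is_cumulant (kap : {ffun E -> 'I_D.+1} -> R) k :=
  forall a, (mgdeg a <= k)%N ->
    \sum_b (mgbin a b)%:R * mgmom a b * kap b = mgrootmom a.

(** A term with nonzero binomial has b <= a, hence either b = a, with coefficient 1, or smaller
    degree. Passing from k to k + 1 therefore solves for the new values without touching the old
    ones. *)
Lemma cumulant_exists k : exists kap, is_cumulant kap k.
Proof.
elim: k => [|k [kap IH]].
  exists mgrootmom => a a0; rewrite (bigD1 a)//= mgbinn mgmomn !mul1r big1 ?addr0// => b ba.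
  have [->|/mgbin_neq0 h] := eqVneq (mgbin a b) 0%N; first by rewrite !mul0r.
  have := mgle_deg_lt h ba; rewrite ltnNge.
  by rewrite (leq_trans a0).
pose kap' a := if (mgdeg a <= k)%N then kap a else
  mgrootmom a - \sum_(b | b != a) (mgbin a b)%:R * mgmom a b * kap b.
exists kap' => a ak.
have [ak'|ak'] := leqP (mgdeg a) k.
  rewrite -(IH a)//; apply: eq_bigr => b _.
  have [->|/mgbin_neq0/mgle_deg h] := eqVneq (mgbin a b) 0%N; first by rewrite !mul0r.
  by rewrite /kap' (leq_trans h).
rewrite (bigD1 a)//= mgbinn mgmomn !mul1r {1}/kap' leqNgt ak' /=.
rewrite -[RHS]addr0 -addrA; congr (_ + _); apply/eqP; rewrite addrC subr_eq0; apply/eqP.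
apply: eq_bigr => b ba.
have [->|/mgbin_neq0 h] := eqVneq (mgbin a b) 0%N; first by rewrite !mul0r.
by rewrite /kap' -ltnS (leq_trans (mgle_deg_lt h ba)).
Qed.

Lemma sum_mgbin (x : R) a : \sum_b (mgbin a b)%:R * x ^+ mgdeg b = (1 + x) ^+ mgdeg a.
Proof.
have E1 b : (mgbin a b)%:R * x ^+ mgdeg b = \prod_e ('C(a e, b e)%:R * x ^+ b e).
  by rewrite big_split /= -prodrXr -natr_prod.
under eq_bigr do rewrite E1.
rewrite -(bigA_distr_bigA (fun e (j : 'I_D.+1) => 'C(a e, j)%:R * x ^+ j)) /mgdeg -prodrXr.
apply: eq_bigr => e _.
rewrite exprDn (big_ord_widen_cond D.+1 xpredT (fun i => 1 ^+ (a e - i) * x ^+ i *+ 'C(a e, i)))//.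
rewrite [RHS]big_mkcond; apply: eq_bigr => j _ /=; rewrite ltnS expr1n mul1r mulr_natl.
by case: leqP => // h; rewrite bin_small.
Qed.

Hypotheses (mu0 : forall e, 0 <= mu e) (mulam : forall e, mu e <= lam).
Hypotheses (rho0 : 0 < rho) (rho1 : rho <= 1).

Lemma mgrootV_sub a b : mgle b a -> mgrootV a \subset mgdiffV a b :|: mgrootV b.
Proof.
move=> /forallP ba; apply/fintype.subsetP => u; rewrite !inE => /orP[->|]; first by rewrite orbT.
move=> /bigcupP[e ae ue]; have [be|be] := posnP (b e).
  by apply/orP; left; apply/bigcupP; exists e; rewrite ?be.
by apply/orP; right; apply/orP; right; apply/bigcupP; exists e.
Qed.

(** Induction on the degree d of a. Every smaller b has |b| + 1 <= d, so the binomial theorem bounds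
    the terms b <> a by (1 + d)^d - d^d, in units of [B]; the root moment adds 1, and 1 <= d^d even
    for d = 0. The powers of rho combine because V(a) is covered by V(a - b) and V(b). *)
Lemma cumulant_bound kap k a : is_cumulant kap k -> (mgdeg a <= k)%N ->
  `|kap a| <= lam ^+ mgdeg a * rho ^+ #|mgrootV a| * (mgdeg a).+1%:R ^+ mgdeg a.
Proof.
move=> hk; have [N] := ubnP (mgdeg a); elim: N => // N IH in a *.
rewrite ltnS => aN ak.
(* Nonnegativity of [lam] is drawn from an edge; if there is none, every degree is 0 and the powers
   of [lam] are 1. *)
have lam0 e : 0 <= lam by apply: le_trans (mulam e).
have prod_le b : mgle b a -> \prod_e mu e ^+ (a e - b e) <= lam ^+ (mgdeg a - mgdeg b).
  move=> /forallP ba; rewrite /mgdeg -sumnB//.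
  rewrite -prodrXr; apply: ler_prod => e _.
  by rewrite exprn_ge0//=; apply: lerXn2r; rewrite ?nnegrE// (lam0 e).
have lamX j : 0 <= lam ^+ (mgdeg a - j).
  have [->|] := posnP (mgdeg a); first by rewrite sub0n.
  rewrite /mgdeg lt0n sum_nat_eq0 => /forallPn[e _].
  by rewrite exprn_ge0// (lam0 e).
have lamd := lamX 0%N; rewrite subn0 in lamd.
have rhoX j : 0 <= rho ^+ j by rewrite exprn_ge0// ltW.
have lamX2 b : mgle b a -> 0 <= lam ^+ mgdeg b.
  have [e _|noE _] := pickP E; first by rewrite exprn_ge0// (lam0 e).
  by rewrite /mgdeg big_pred0.
have E0 : kap a = mgrootmom a - \sum_(b | b != a) (mgbin a b)%:R * mgmom a b * kap b.
  by rewrite -(hk a)// (bigD1 a)//= mgbinn mgmomn !mul1r addrK.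
set B := lam ^+ mgdeg a * rho ^+ #|mgrootV a|.
have B0 : 0 <= B by rewrite mulr_ge0.
have h1 : `|mgrootmom a| <= B.
  rewrite ger0_norm; last by rewrite mulr_ge0// prodr_ge0// => e _; rewrite exprn_ge0.
  rewrite ler_wpM2r// /mgdeg -prodrXr.
  by apply: ler_prod => e _; rewrite exprn_ge0//=; apply: lerXn2r; rewrite ?nnegrE// (lam0 e).
have h2 b : b != a -> `|(mgbin a b)%:R * mgmom a b * kap b| <=
    B * ((mgbin a b)%:R * (mgdeg a)%:R ^+ mgdeg b).
  move=> ba; have [->|/mgbin_neq0 h] := eqVneq (mgbin a b) 0%N.
    by rewrite !mul0r normr0 mulr0.
  have lt := mgle_deg_lt h ba; have le := ltnW lt.
  rewrite -mulrA normrM normr_nat normrM [leRHS]mulrCA ler_wpM2l//.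
  have m0 : 0 <= mgmom a b.
    by rewrite mulr_ge0// prodr_ge0// => e _; rewrite exprn_ge0.
  rewrite (ger0_norm m0).
  apply: (@le_trans _ _ ((lam ^+ (mgdeg a - mgdeg b) * rho ^+ #|mgdiffV a b|) *
     (lam ^+ mgdeg b * rho ^+ #|mgrootV b| * (mgdeg b).+1%:R ^+ mgdeg b))).
    apply: ler_pM => //.
      by rewrite ler_wpM2r// prod_le.
    by apply: IH; [exact: leq_trans aN|exact: leq_trans ak].
  rewrite mulrA mulrACA -exprD subnK// -exprD.
  apply: ler_pM.
  - by rewrite mulr_ge0.
  - by rewrite exprn_ge0.
  - rewrite /B ler_wpM2l//.
    apply: ler_wiXn2l; rewrite ?(ltW rho0)//.
    apply: (leq_trans (subset_leq_card (mgrootV_sub h))).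
    by rewrite cardsU leq_subr.
  - by apply: lerXn2r; rewrite ?nnegrE// ler_nat.
rewrite E0; apply: (le_trans (ler_normB _ _)).
apply: (le_trans (lerD h1 (ler_norm_sum _ _ _))).
have h3 : \sum_(b | b != a) `|(mgbin a b)%:R * mgmom a b * kap b| <=
    \sum_(b | b != a) B * ((mgbin a b)%:R * (mgdeg a)%:R ^+ mgdeg b).
  by apply: ler_sum => b; exact: h2.
apply: (le_trans (lerD (lexx _) h3)).
rewrite -mulr_sumr -{1}[B]mulr1 -mulrDr ler_wpM2l//.
have := sum_mgbin (mgdeg a)%:R a; rewrite (bigD1 a)//= mgbinn mul1r.
rewrite [1 + _ in RHS]addrC -natr1 => <-; rewrite lerD2r.
case: (mgdeg a) => [|j]; first by rewrite expr0.
by rewrite exprn_ege1// ler1n.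
Qed.
End cumulants.
End multigraph.

(** * Cumulants vanish on multigraphs not connected to the root *)

Section vanishing.
Context {R : realFieldType} (U E : finType) (D : nat) (ends : E -> {set U}) (i0 : U).
Implicit Types (a b : {ffun E -> 'I_D.+1}) (e : E).
Variables (mu : E -> R) (rho : R).

(* By induction, in the equation of a only kap a and the terms supported inside C
   survive; the latter sum up to the equation of the part of a inside C, multiplied
   by the moment of the part outside. *)
Lemma cumulant_split (kap : {ffun E -> 'I_D.+1} -> R) k (C : {set U}) a :
  is_cumulant ends i0 mu rho kap k -> i0 \in C -> (mgdeg a <= k)%N ->
  (forall e, (0 < a e)%N -> (ends e \subset C) || [disjoint ends e & C]) ->
  (exists e, (0 < a e)%N && ~~ (ends e \subset C)) -> kap a = 0.
Proof.
move=> hk iC; have [N] := ubnP (mgdeg a); elim: N => // N IH in a *.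
rewrite ltnS => aN ak aC [e0 /andP[ae0 e0C]].
pose inC b := [forall e, (0 < b e)%N ==> (ends e \subset C)].
(* [a1] is the part of [a] inside [C], and [w] is the moment of the part outside, whose vertex set
   [V2] avoids [C]. *)
pose a1 : {ffun E -> 'I_D.+1} := [ffun e => if ends e \subset C then a e else ord0].
pose V2 : {set U} := \bigcup_(e | (0 < a e)%N && ~~ (ends e \subset C)) ends e.
pose w := (\prod_(e | ~~ (ends e \subset C)) mu e ^+ a e) * rho ^+ #|V2|.
have V2C (A : {set U}) : A \subset C -> [disjoint A & V2].
  move=> sAC; apply: (fintype.disjointWl sAC).
  apply/bigcup_disjointP => e /andP[ae eC]; rewrite disjoint_sym.
  by have := aC e ae; rewrite (negbTE eC).
have cardV2 (A : {set U}) : A \subset C -> #|A :|: V2| = (#|A| + #|V2|)%N.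
  by move=> /V2C dis; rewrite cardsU (finset.disjoint_setI0 dis) cards0 subn0.
have prodS (F : E -> R) : \prod_e F e =
    (\prod_(e | ends e \subset C) F e) * \prod_(e | ~~ (ends e \subset C)) F e.
  by rewrite (bigID (fun e => ends e \subset C)).
have inCP b e : inC b -> ~~ (ends e \subset C) -> b e = 0%N :> nat.
  move=> /forallP /(_ e); case: posnP => // _ /=.
  by move=> ->.
have momE b : inC b -> mgmom ends mu rho a b = mgmom ends mu rho a1 b * w.
  move=> bC; rewrite /mgmom /w mulrACA; congr (_ * _).
    rewrite (prodS (fun e => mu e ^+ (a e - b e))) (prodS (fun e => mu e ^+ (a1 e - b e))).
    rewrite [X in _ = _ * X * _]big1 => [|e eC]; last by rewrite ffunE (negbTE eC) sub0n.
    rewrite mulr1; congr (_ * _).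
      by apply: eq_bigr => e eC; rewrite ffunE eC.
    by apply: eq_bigr => e eC; rewrite (inCP b)// subn0.
  rewrite -exprD; congr (_ ^+ _); rewrite -cardV2; last first.
    apply/bigcupsP => e; rewrite ffunE; case: ifP => //= _; rewrite ltn0.
  congr #|pred_of_set _|; apply/setP => u; rewrite inE.
  apply/bigcupP/orP => [[e be ue]|[/bigcupP[e be ue]|/bigcupP[e /andP[ae eC] ue]]].
  - have [eC|eC] := boolP (ends e \subset C).
      by left; apply/bigcupP; exists e => //; rewrite ffunE eC.
    by right; apply/bigcupP; exists e => //; rewrite eC (leq_ltn_trans _ be).
  - exists e => //; move: be; rewrite ffunE; case: ifP => //= _; rewrite ltn0.
  - by exists e => //; rewrite (inCP b).
have rootE : mgrootmom ends i0 mu rho a = mgrootmom ends i0 mu rho a1 * w.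
  rewrite /mgrootmom /w mulrACA; congr (_ * _).
    rewrite (prodS (fun e => mu e ^+ a e)) (prodS (fun e => mu e ^+ a1 e)).
    rewrite [X in _ = _ * X * _]big1 => [|e eC]; last by rewrite ffunE (negbTE eC).
    rewrite mulr1; congr (_ * _).
    by apply: eq_bigr => e eC; rewrite ffunE eC.
  rewrite -exprD; congr (_ ^+ _); rewrite -cardV2; last first.
    rewrite finset.subUset finset.sub1set iC /=.
    apply/bigcupsP => e; rewrite ffunE; case: ifP => //.
  congr #|pred_of_set _|; rewrite /mgrootV -finset.setUA; congr (_ :|: _).
  apply/setP => u; rewrite inE.
  apply/bigcupP/orP => [[e be ue]|[/bigcupP[e be ue]|/bigcupP[e /andP[ae eC] ue]]].
  - have [eC|eC] := boolP (ends e \subset C).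
      by left; apply/bigcupP; exists e => //; rewrite ffunE eC.
    by right; apply/bigcupP; exists e => //; rewrite eC be.
  - by exists e => //; move: be; rewrite ffunE; case: ifP.
  - by exists e.
have binE b : inC b -> mgbin a b = mgbin a1 b.
  move=> bC; apply: eq_bigr => e _; rewrite ffunE; case: ifP => // /negbT eC.
  by rewrite (inCP b)// !bin0.
have bin0E b : ~~ inC b -> mgbin a1 b = 0%N.
  move=> /forallPn[e]; rewrite negb_imply => /andP[be eC].
  by rewrite /mgbin (bigD1 e)//= ffunE (negbTE eC) bin_small.
have a1a : mgle a1 a by apply/forallP => e; rewrite ffunE; case: ifP.
have naC : ~~ inC a by apply/forallPn; exists e0; rewrite ae0.
have H1 := hk _ ak; have H2 := hk _ (leq_trans (mgle_deg a1a) ak).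
rewrite (bigID inC)/= in H1; rewrite (bigID inC)/= in H2.
rewrite [X in _ + X = _]big1 ?addr0 in H2; last first.
  by move=> b /bin0E ->; rewrite !mul0r.
rewrite (eq_bigr (fun b => (mgbin a1 b)%:R * mgmom ends mu rho a1 b * kap b * w)) in H1; last first.
  by move=> b bC; rewrite binE// momE//; ring.
rewrite -mulr_suml H2 -rootE in H1.
(* What is left says that the terms not supported in [C] sum to 0; all of them except that of [a]
   vanish by induction. *)
move: H1 => /(canRL (addKr _)); rewrite addNr (bigD1 a)//= mgbinn mgmomn !mul1r.
rewrite big1 ?addr0// => b /andP[bC ba].
have [->|/mgbin_neq0 h] := eqVneq (mgbin a b) 0%N; first by rewrite !mul0r.
rewrite IH ?mulr0//.
- exact: leq_trans (mgle_deg_lt h ba) aN.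
- exact: leq_trans (mgle_deg h) ak.
- by move=> e be; apply: aC; apply: leq_trans be _; move/forallP: h.
- by move: bC => /forallPn[e]; rewrite negb_imply => be; exists e.
Qed.

(* the multigraphs built by adding k edges one at a time, each touching the
   vertices reached so far from the root i0 *)
Fixpoint mggrown k a : bool :=
  if k is k'.+1 then
    [exists b, exists e, [&& mggrown k' b, ~~ [disjoint ends e & mgrootV ends i0 b] &
       [forall e', (a e' : nat) == b e' + (e' == e)]]]%N
  else a == [ffun=> ord0].

Lemma mggrown_deg k a : mggrown k a -> mgdeg a = k.
Proof.
elim: k a => [|k IH] a /=.
  by move=> /eqP ->; rewrite /mgdeg big1// => e _; rewrite ffunE.
move=> /existsP[b /existsP[e /and3P[/IH <- _ /forallP h]]].
rewrite /mgdeg (eq_bigr (fun e' => b e' + (e' == e)))%N; last by move=> e' _; exact/eqP.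
have s1 : (\sum_e' (e' == e) = 1)%N.
  by rewrite (bigD1 e)//= eqxx big1// => e' /negbTE ->.
by rewrite big_split /= s1 addn1.
Qed.

(** Take a grown b <= a of maximal degree and let C be its vertex set. By maximality an edge with b
    e < a e avoids C, since otherwise it could be added, while the edges of b lie in C. As b <> a,
    some edge of a lies outside C and [cumulant_split] applies. *)
Lemma cumulant_vanish (ends0 : forall e, ends e != finset.set0) (kap : {ffun E -> 'I_D.+1} -> R) k a :
  is_cumulant ends i0 mu rho kap k -> (mgdeg a <= k)%N ->
  ~~ mggrown (mgdeg a) a -> kap a = 0.
Proof.
move=> hk ak na.
pose Q b := mgle b a && mggrown (mgdeg b) b.
pose z : {ffun E -> 'I_D.+1} := [ffun=> ord0].
have Qz : Q z.
  apply/andP; split; first by apply/forallP => e; rewrite ffunE.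
  have -> : mgdeg z = 0%N by rewrite /mgdeg big1// => e _; rewrite ffunE.
  by rewrite /=.
case: (@arg_maxnP _ z Q (@mgdeg E D) Qz) => b /andP[ba gb] bmax.
have neq : b != a by apply: contraNneq na => <-.
have ext e : (b e < a e)%N -> [disjoint ends e & mgrootV ends i0 b].
  move=> lt; apply: contraT => nd.
  have bD : ((b e).+1 < D.+1)%N by apply: leq_ltn_trans lt _.
  pose b' : {ffun E -> 'I_D.+1} := [ffun e' => if e' == e then Ordinal bD else b e'].
  have b'E e' : b' e' = (b e' + (e' == e))%N :> nat.
    by rewrite ffunE; case: eqP => [->|]; rewrite ?addn1 ?addn0.
  have gb' : mggrown (mgdeg b).+1 b'.
    apply/existsP; exists b; apply/existsP; exists e.
    by apply/and3P; split=> //; apply/forallP => e'; rewrite b'E.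
  have Qb' : Q b'.
    rewrite /Q (mggrown_deg gb') gb' andbT.
    apply/forallP => e'; rewrite b'E; case: eqP => [->|_]; first by rewrite addn1.
    by rewrite addn0; move/forallP: ba.
  by have := bmax _ Qb'; rewrite (mggrown_deg gb') /= ltnn.
have inb e : (0 < b e)%N -> ends e \subset mgrootV ends i0 b.
  by move=> be; apply: fintype.subset_trans (finset.subsetUr _ _); rewrite (finset.bigcup_sup e).
apply: (@cumulant_split kap k (mgrootV ends i0 b) a hk) => //.
- by rewrite !inE eqxx.
- move=> e ae; have [|lt] := leqP (a e) (b e).
    by move=> ab; rewrite inb// (leq_trans ae).
  by rewrite ext ?orbT.
- have /forallPn[e] : ~~ [forall e, (a e <= b e)%N].
    apply: contra neq => ab; apply/eqP; apply: mgle_deg_eq => //.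
    exact: mgle_deg.
  rewrite -ltnNge => lt; have dis := ext _ lt.
  exists e; rewrite (leq_ltn_trans _ lt)//=.
  apply: contra (ends0 e) => sub.
  by rewrite -(finset.setIidPl sub); move: dis; rewrite -finset.setI_eq0.
Qed.
End vanishing.

(** * Weighted count of the multigraphs grown from the root *)

Section counting.
Context {R : realFieldType} (U E : finType) (D : nat) (ends : E -> {set U}) (i0 : U).
Implicit Types (a b : {ffun E -> 'I_D.+1}) (e : E).
Variables (edge : U -> U -> E).
Hypothesis endsE : forall u w, ends (edge u w) = [set u; w].
Hypothesis edgeP : forall e u, u \in ends e -> exists w, edge u w = e.

Local Notation V := (mgrootV ends i0).

Definition mgadd a b e := [forall e', (a e' : nat) == b e' + (e' == e)]%N.

Lemma mgadd_rootV a b e : mgadd a b e -> V a = V b :|: ends e.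
Proof.
move=> /forallP h; rewrite /mgrootV -finset.setUA; congr (_ :|: _).
apply/setP => u; rewrite inE; apply/bigcupP/orP => [[e' ae' ue']|[/bigcupP[e' be' ue']|ue]].
- move: ae'; rewrite (eqP (h e')); have [ee|ne] := eqVneq e' e.
    by right; rewrite -ee.
  by rewrite addn0 => be; left; apply/bigcupP; exists e'.
- by exists e' => //; rewrite (eqP (h e')) (leq_trans be')// leq_addr.
- by exists e => //; rewrite (eqP (h e)) eqxx addn1.
Qed.

(** An edge that meets V(b) at u has one further end w, equal to u for a loop, so growth adds at
    most one vertex. *)
Lemma card_touching e b : ~~ [disjoint ends e & V b] ->
  exists u w, [/\ u \in V b, edge u w = e & V b :|: ends e = w |: V b].
Proof.
rewrite -finset.setI_eq0 => /finset.set0Pn[u]; rewrite inE => /andP[ue uV].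
have [w we] := edgeP ue; exists u, w; split=> //.
rewrite -we endsE; apply/setP => y; rewrite finset.in_setU finset.in_set2 finset.in_setU1.
by have [->|_] := eqVneq y u; [rewrite uV !orbT|rewrite orFb orbC].
Qed.

Lemma mggrown_card k a : mggrown ends i0 k a -> (#|V a| <= k.+1)%N.
Proof.
elim: k a => [|k IH] a /=.
  move=> /eqP ->; rewrite /mgrootV big_pred0 => [|e]; last by rewrite ffunE ltnn.
  by rewrite finset.setU0 cards1.
move=> /existsP[b /existsP[e /and3P[gb /card_touching[u [w [_ _ VE]]] ab]]].
by rewrite (mgadd_rootV ab) VE cardsU1 -[k.+2]add1n leq_add ?IH//; case: (_ \in _).
Qed.

Variable x : R.
Hypothesis x0 : 0 <= x.

(** Edges are overcounted by pairs (u, w) with u in V(b). A new vertex w costs a factor x and has at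
    most |U| choices; an old one costs nothing and has |V(b)| choices. *)
Lemma sum_touching b :
  \sum_(e | ~~ [disjoint ends e & V b]) x ^+ #|V b :|: ends e| <=
  (#|V b|)%:R * (#|U|%:R * x + #|V b|%:R) * x ^+ #|V b|.
Proof.
pose g e := x ^+ #|V b :|: ends e|.
have g0 e : 0 <= g e by exact: exprn_ge0.
apply: (@le_trans _ _ (\sum_(u in V b) \sum_w g (edge u w))).
  have -> : \sum_(u in V b) \sum_w g (edge u w) =
      \sum_e \sum_(u in V b) \sum_(w | edge u w == e) g e.
    rewrite [RHS]exchange_big /=; apply: eq_bigr => u _.
    rewrite [RHS](exchange_big_dep xpredT)//=; apply: eq_bigr => w _.
    by rewrite (big_pred1 (edge u w))// => e; rewrite eq_sym.
  rewrite big_mkcond; apply: ler_sum => e _; case: ifP => [te|_]; last first.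
    by rewrite sumr_ge0// => u _; rewrite sumr_ge0.
  have [u [w [uV we _]]] := card_touching te.
  rewrite (bigD1 u)//= (bigD1 w)/=; last by rewrite we.
  rewrite -addrA lerDl addr_ge0// sumr_ge0// => u' _; by rewrite sumr_ge0.
apply: (@le_trans _ _ (\sum_(u in V b) (#|U|%:R * x + #|V b|%:R) * x ^+ #|V b|)); last first.
  rewrite sumr_const -[leRHS]mulrA [leRHS]mulr_natl; exact: lexx.
apply: ler_sum => u uV.
apply: (@le_trans _ _ (\sum_w (x * x ^+ #|V b| + (w \in V b)%:R * x ^+ #|V b|))).
  apply: ler_sum => w _; rewrite /g endsE.
  have -> : V b :|: [set u; w] = w |: V b.
    apply/setP => y; rewrite finset.in_setU finset.in_set2 finset.in_setU1.
    by have [->|_] := eqVneq y u; [rewrite uV !orbT|rewrite orFb orbC].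
  rewrite cardsU1; case: (w \in V b) => /=.
    by rewrite add0n mul1r lerDr mulr_ge0// exprn_ge0.
  by rewrite add1n exprS mul0r addr0.
have s1 : (\sum_w (w \in V b) = #|V b|)%N.
  by rewrite -sum1_card [RHS]big_mkcond; apply: eq_bigr => w _; case: (w \in _).
rewrite big_split /= sumr_const -mulr_suml -natr_sum s1 mulrDl.
rewrite -mulrA lerD2r [leRHS]mulr_natl (@eq_card _ xpredT U) ?lexx//.
Qed.

(** Each grown multigraph has some last edge, so summing over all pairs (b, e) only overcounts. Such
    a pair determines a, if a exists at all under the cap D on multiplicities. The leading x is the
    root. *)
Lemma sum_mggrown k :
  \sum_(a : {ffun E -> 'I_D.+1} | mggrown ends i0 k a) x ^+ #|V a| <=
  x * \prod_(i < k) (i.+1%:R * (#|U|%:R * x + i.+1%:R)).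
Proof.
elim: k => [|k IH].
  rewrite (big_pred1 [ffun=> ord0])//= big_ord0 mulr1.
  rewrite /mgrootV big_pred0 => [|e]; last by rewrite ffunE ltnn.
  by rewrite finset.setU0 cards1.
rewrite big_ord_recr /= mulrA.
apply: (@le_trans _ _ ((\sum_(b : {ffun E -> 'I_D.+1} | mggrown ends i0 k b) x ^+ #|V b|) * (k.+1%:R * (#|U|%:R * x + k.+1%:R)))); last first.
  by rewrite ler_wpM2r// mulr_ge0// addr_ge0// mulr_ge0.
rewrite mulr_suml.
apply: (@le_trans _ _ (\sum_(b : {ffun E -> 'I_D.+1} | mggrown ends i0 k b)
  \sum_(e | ~~ [disjoint ends e & V b]) \sum_(a : {ffun E -> 'I_D.+1} | mgadd a b e) x ^+ #|V a|)).
  rewrite [leRHS](_ : _ = \sum_(a : {ffun E -> 'I_D.+1}) \sum_(b : {ffun E -> 'I_D.+1} | mggrown ends i0 k b)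
    \sum_(e | ~~ [disjoint ends e & V b] && mgadd a b e) x ^+ #|V a|); last first.
    rewrite exchange_big /=; apply: eq_bigr => b _.
    rewrite [RHS](exchange_big_dep (fun e => ~~ [disjoint ends e & V b]))//=; last by move=> a e _ /andP[].
    by apply: eq_bigr => e te; apply: eq_bigl => a; rewrite te.
  rewrite big_mkcond; apply: ler_sum => a _; case: ifP => [|_]; last first.
    by rewrite sumr_ge0// => b _; rewrite sumr_ge0// => e _; exact: exprn_ge0.
  move=> /existsP[b /existsP[e /and3P[gb te ab]]].
  rewrite (bigD1 b)//= (bigD1 e)/=; last by rewrite te.
  rewrite -addrA lerDl addr_ge0// sumr_ge0// => [e' _|b' _]; first exact: exprn_ge0.
  by rewrite sumr_ge0// => e' _; exact: exprn_ge0.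
apply: ler_sum => b gb.
apply: (@le_trans _ _ (\sum_(e | ~~ [disjoint ends e & V b]) x ^+ #|V b :|: ends e|)).
  apply: ler_sum => e te.
  have [a ab|noa] := pickP (fun a => mgadd a b e); last first.
    by rewrite big_pred0// exprn_ge0.
  rewrite (big_pred1 a); first by rewrite (mgadd_rootV ab).
  move=> a'; apply/idP/eqP => [/forallP h|->//].
  apply/ffunP => e'; apply/val_inj => /=; rewrite (eqP (h e')).
  by move/forallP: ab => /(_ e') /eqP ->.
apply: (le_trans (sum_touching b)); rewrite mulrC ler_wpM2l ?exprn_ge0//.
have c := mggrown_card gb.
by apply: ler_pM; rewrite ?ler_nat ?addr_ge0 ?mulr_ge0// lerD2l ler_nat.
Qed.
End counting.

(** * The sum of the squared cumulants *)

Section cumulant_sum.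
Context {R : realFieldType} (U E : finType) (D : nat) (ends : E -> {set U}) (i0 : U).
Variables (edge : U -> U -> E).
Hypothesis endsE : forall u w, ends (edge u w) = [set u; w].
Hypothesis edgeP : forall e u, u \in ends e -> exists w, edge u w = e.
Hypothesis ends0 : forall e, ends e != finset.set0.
Variables (mu : E -> R) (rho lam r q : R).
Hypotheses (mu0 : forall e, 0 <= mu e) (mulam : forall e, mu e <= lam).
Hypotheses (rho0 : 0 < rho) (rho1 : rho <= 1) (r0 : 0 < r) (r1 : r < 1) (lam0 : 0 <= lam).
Hypotheses (q1 : 1 <= q) (qU : #|U|%:R * rho ^+ 2 <= q).
Hypothesis lamq : lam ^+ 2 * q * (D * D.+1)%:R ^+ 2 <= r ^+ 2.

(** The derivative of a geometric series: multiplied by (1 - t)^2, the partial sum has a closed form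
    that is at most 1. *)
Lemma geometric_deriv_sum (t : R) j : 0 <= t -> t < 1 ->
  \sum_(k < j) k.+1%:R * t ^+ k <= (1 - t) ^- 2.
Proof.
move=> t0 t1; have h : (1 - t) ^+ 2 * \sum_(k < j) k.+1%:R * t ^+ k =
    1 - j.+1%:R * t ^+ j + j%:R * t ^+ j.+1.
  elim: j => [|j IH]; first by rewrite big_ord0 expr0; ring.
  rewrite big_ord_recr /= mulrDr IH !exprS -!natr1; ring.
have p0 : 0 < (1 - t) ^+ 2 by rewrite exprn_gt0// subr_gt0.
rewrite -(ler_pM2l p0) h mulfV ?gt_eqF//.
have tj : 0 <= t ^+ j by rewrite exprn_ge0.
have : j%:R * t ^+ j.+1 <= j.+1%:R * t ^+ j.
  rewrite exprS mulrA ler_wpM2r// -natr1.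
  have : j%:R * t <= j%:R * 1 :> R by rewrite ler_wpM2l// ltW.
  lra.
lra.
Qed.

(** Only grown multigraphs contribute. In degree k the squared cumulant bound gives lam^(2k)
    (k+1)^(2k), with weight rho^(2|V|); the count at x = rho^2 gives at most rho^2 (k+1) (k^2 q)^k.
    The product is rho^2 (k+1) (lam^2 q (k(k+1))^2)^k, so the hypothesis [lamq] leaves rho^2 (k+1)
    r^(2k). *)
Lemma cumulant_sum (kap : {ffun E -> 'I_D.+1} -> R) :
  is_cumulant ends i0 mu rho kap D ->
  \sum_(a : {ffun E -> 'I_D.+1} | (mgdeg a <= D)%N) kap a ^+ 2 <= rho ^+ 2 / (1 - r ^+ 2) ^+ 2.
Proof.
move=> hk.
pose G k (a : {ffun E -> 'I_D.+1}) := mggrown ends i0 k a.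
apply: (@le_trans _ _ (\sum_(k < D.+1) \sum_(a : {ffun E -> 'I_D.+1} | G k a) kap a ^+ 2)).
  rewrite [leRHS](exchange_big_dep xpredT)//= big_mkcond; apply: ler_sum => a _.
  have s0 (A : pred 'I_D.+1) : 0 <= \sum_(k | A k) kap a ^+ 2 by rewrite sumr_ge0// => k _; exact: sqr_ge0.
  case: ifP => // aD; have [g|ng] := boolP (mggrown ends i0 (mgdeg a) a).
    have aD' : (mgdeg a < D.+1)%N by [].
    by rewrite (bigD1 (Ordinal aD'))//= lerDl s0.
  rewrite [leLHS](_ : _ = 0); first exact: s0.
  by rewrite (cumulant_vanish ends0 hk)// expr0n.
apply: (@le_trans _ _ (\sum_(k < D.+1) rho ^+ 2 * (k.+1%:R * (r ^+ 2) ^+ k))); last first.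
  rewrite -mulr_sumr ler_wpM2l ?sqr_ge0// geometric_deriv_sum ?sqr_ge0//.
  by rewrite expr_lt1// ltW.
apply: ler_sum => -[k kD] _ /=.
apply: (@le_trans _ _ (\sum_(a : {ffun E -> 'I_D.+1} | G k a) (lam ^+ k * k.+1%:R ^+ k) ^+ 2 * (rho ^+ 2) ^+ #|mgrootV ends i0 a|)).
  apply: ler_sum => a ga; have dk := mggrown_deg ga.
  have := cumulant_bound mu0 mulam rho0 rho1 hk (a := a); rewrite dk => /(_ kD) hb.
  rewrite -exprM mulnC exprM -exprMn -[leLHS]real_normK ?num_real//.
  apply: lerXn2r; rewrite ?nnegrE//; last by rewrite [leRHS]mulrAC.
  by rewrite !mulr_ge0// ?exprn_ge0// ltW.
rewrite -mulr_sumr.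
have rho2 : 0 <= rho ^+ 2 := sqr_ge0 rho.
have hs := sum_mggrown D i0 endsE edgeP rho2 k.
apply: (le_trans (ler_wpM2l (sqr_ge0 (lam ^+ k * k.+1%:R ^+ k)) hs)).
rewrite mulrCA ler_wpM2l//.
have q0 : 0 <= q by apply: le_trans q1.
have hp : \prod_(i < k) (i.+1%:R * (#|U|%:R * rho ^+ 2 + i.+1%:R)) <=
    k.+1%:R * (k%:R ^+ 2 * q) ^+ k :> R.
  (* Since q >= 1, each factor |U| rho^2 + i + 1 is at most q (i + 2), and the product of the (i +
     1)(i + 2) is (k + 1) k!^2. *)
  apply: (@le_trans _ _ (k.+1%:R * k`!%:R ^+ 2 * q ^+ k)).
    elim: (k) => [|j IH]; first by rewrite big_ord0 fact0 expr0 expr1n !mulr1.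
    rewrite big_ord_recr /=.
    apply: (@le_trans _ _ ((j.+1%:R * j`!%:R ^+ 2 * q ^+ j) * (j.+1%:R * (q * j.+2%:R)))).
      apply: ler_pM => //.
      - by rewrite prodr_ge0// => i _; rewrite mulr_ge0// addr_ge0// mulr_ge0.
      - by rewrite mulr_ge0// addr_ge0// mulr_ge0.
      - rewrite ler_wpM2l// -[j.+2]add1n natrD mulrDr mulr1 lerD//.
        by rewrite -[leLHS]mul1r ler_wpM2r.
    rewrite factS natrM exprMn [q ^+ j.+1]exprS le_eqVlt; apply/orP; left; apply/eqP.
    by rewrite ?expr2; ring.
  rewrite -mulrA ler_wpM2l// exprMn ler_wpM2r ?exprn_ge0// -exprM mulnC exprM.
  apply: lerXn2r; rewrite ?nnegrE ?exprn_ge0// -natrX ler_nat.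
  elim: (k) => // j IH; rewrite factS expnS leq_mul//.
  by apply: (leq_trans IH); case: (j) => // i; rewrite leq_exp2r.
apply: (le_trans (ler_wpM2l (sqr_ge0 (lam ^+ k * k.+1%:R ^+ k)) hp)).
have -> : (lam ^+ k * k.+1%:R ^+ k) ^+ 2 * (k.+1%:R * (k%:R ^+ 2 * q) ^+ k) =
    k.+1%:R * (lam ^+ 2 * q * (k * k.+1)%:R ^+ 2) ^+ k.
  rewrite natrM !exprMn ?expr2.
  by ring.
rewrite ler_wpM2l//; apply: lerXn2r; rewrite ?nnegrE ?mulr_ge0 ?sqr_ge0 ?(ltW r0)//.
apply: le_trans lamq.
rewrite ler_wpM2l ?mulr_ge0 ?sqr_ge0//.
by apply: lerXn2r; rewrite ?nnegrE// ler_nat leq_mul.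
Qed.
End cumulant_sum.

(** * Lower bound *)

Section lower_bound.
Context d (T : measurableType d) (R : realType) (P : probability T R).
Variables (U E : finType) (D : nat) (e1 e2 : E -> U) (i0 : U).
Implicit Types (a b : {ffun E -> 'I_D.+1}) (e : E).
Let ends e : {set U} := [set e1 e; e2 e].
Variables (v : U -> T -> R) (Z : E -> T -> R) (mu : E -> R) (rho : R).
Local Notation Ex := (Ex P).
Local Notation allmom := (allmom P).
Hypotheses (v01 : forall i t, v i t = 0 \/ v i t = 1).
Hypotheses (mv : forall i, allmom (v i)) (mZ : forall e, allmom (Z e)).
Hypothesis indep : forall (S : {set U}) (p : E -> {poly R}),
  Ex (fun t => (\prod_(i in S) v i t) * \prod_e (p e).[Z e t]) =
  rho ^+ #|S| * \prod_e Ex (fun t => (p e).[Z e t]).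
Hypothesis orth : forall e j k,
  Ex (fun t => (hermite j).[Z e t] * (hermite k).[Z e t]) = (j`!)%:R *+ (j == k).

Let X e t : R := mu e * v (e1 e) t * v (e2 e) t.
Let H (k : {ffun E -> 'I_D.+1}) (z : E -> R) : R := \prod_e (hermite (k e)).[z e].

(** 0/1 values are idempotent, so vertices common to both sets count once. *)
Lemma prod_boolvars (A : {set U}) (B : {set U}) t :
  (\prod_(i in A) v i t) * (\prod_(i in B) v i t) = \prod_(i in A :|: B) v i t.
Proof.
have [/forall_inP h|/forall_inPn[i iAB vi]] := boolP [forall (i | i \in A :|: B), v i t == 1].
  rewrite !big1 ?mulr1// => i hi; apply/eqP/h; rewrite ?inE ?hi ?orbT//.
  by rewrite inE in hi.
have v0 : v i t = 0 by case: (v01 i t) vi => // ->; rewrite eqxx.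
rewrite [RHS](bigD1 i)//= v0 mul0r.
move: iAB; rewrite inE => /orP[iA|iB].
  by rewrite (bigD1 i iA)/= v0 !mul0r.
by rewrite (bigD1 i iB)/= v0 mul0r mulr0.
Qed.

Lemma prod_signal (k : E -> nat) t :
  \prod_e X e t ^+ k e =
  (\prod_e mu e ^+ k e) * \prod_(i in \bigcup_(e | (0 < k e)%N) ends e) v i t.
Proof.
have XE e : X e t ^+ k e = mu e ^+ k e * (if (0 < k e)%N then \prod_(i in ends e) v i t else 1).
  have vv i j : v i t * v j t = \prod_(l in [set i; j]) v l t.
    rewrite -(big_set1 *%R i (fun l => v l t)) -(big_set1 *%R j (fun l => v l t)).
    by rewrite prod_boolvars.
  rewrite /X -mulrA exprMn vv; congr (_ * _); case: (k e) => [|j] /=; first by rewrite expr0.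
  case: (v01 (e1 e) t) (v01 (e2 e) t) => [h1|h1] [h2|h2];
    by rewrite -vv h1 h2 ?mulr0 ?mul0r ?mulr1 ?expr1n ?expr0n.
under eq_bigr do rewrite XE.
rewrite big_split /=; congr (_ * _); rewrite -big_mkcond /=.
pose Q (A : {set U}) (x : R) := x = \prod_(i in A) v i t.
suff : Q (\bigcup_(e | (0 < k e)%N) ends e) (\prod_(e | (0 < k e)%N) \prod_(i in ends e) v i t) by [].
apply: (big_rec2 Q); first by rewrite /Q big_set0.
by move=> e A x ke ->; rewrite /Q prod_boolvars.
Qed.

Let mX e : allmom (X e).
Proof. by apply: allmomM => //; apply: allmomZ. Qed.

Let Xb a b t := \prod_(i in mgdiffV ends a b) v i t.

Lemma hermite_signal a t :
  H a (fun e => X e t + Z e t) =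
  \sum_b (mgbin a b)%:R * (\prod_e mu e ^+ (a e - b e)) * (Xb a b t * H b (fun e => Z e t)).
Proof.
rewrite /H.
under eq_bigr do rewrite (@hermiteD _ D) ?leq_ord//.
rewrite bigA_distr_bigA; apply: eq_bigr => b _.
rewrite !big_split /= prod_signal /mgbin natr_prod !mulrA.
congr (_ * _ * _ * _).
rewrite /Xb /mgdiffV; apply: eq_bigl => i; congr (i \in _).
rewrite (eq_bigl (fun e => (b e < a e)%N))// => e; by rewrite subn_gt0.
Qed.

Let Ex_hermite2 (S : {set U}) b c :
  Ex (fun t => (\prod_(i in S) v i t) * (H b (fun e => Z e t) * H c (fun e => Z e t))) =
  rho ^+ #|S| * (\prod_e (b e)`!%:R) *+ (b == c).
Proof.
under eq_fun do rewrite /H -big_split /=.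
have -> : (fun t => (\prod_(i in S) v i t) * \prod_e ((hermite (b e)).[Z e t] * (hermite (c e)).[Z e t])) =
  (fun t => (\prod_(i in S) v i t) * \prod_e (hermite (b e) * hermite (c e)).[Z e t]).
  by apply/funext => t; congr (_ * _); apply: eq_bigr => e _; rewrite hornerM.
rewrite indep -mulrnAr; congr (_ * _).
have -> : \prod_e Ex (fun t => (hermite (b e) * hermite (c e)).[Z e t]) =
    \prod_e ((b e)`!%:R *+ (b e == c e)).
  apply: eq_bigr => e _; rewrite -val_eqE -(orth e); congr (Ex _).
  by apply/funext => t; rewrite hornerM.
have [->|ne] := eqVneq b c.
  by rewrite mulr1n; apply: eq_bigr => e _; rewrite eqxx.
have [e ne'] : exists e, b e != c e.
  by apply/existsP; apply: contraR ne => /existsPn h; apply/eqP/ffunP => e; apply/eqP; rewrite -[_ == _]negbK.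
by rewrite (bigD1 e)//= (negbTE ne') mul0r.
Qed.

Let H0 z : H [ffun=> ord0] z = 1.
Proof. by rewrite /H big1// => e _; rewrite ffunE /= hornerC. Qed.

Let mH b : allmom (fun t => H b (fun e => Z e t)).
Proof. by apply: allmom_prod => e; exact: allmom_horner. Qed.

Let mHY b : allmom (fun t => H b (fun e => X e t + Z e t)).
Proof. by apply: allmom_prod => e; apply: allmom_horner; exact: allmomD. Qed.

Let mXb (A : {set U}) : allmom (fun t => \prod_(i in A) v i t).
Proof. by apply: allmom_prod => e. Qed.

Let fct b : R := \prod_e (b e)`!%:R.
Let fct1 b : 1 <= fct b.
Proof.
rewrite /fct -natr_prod ler1n; apply/prodn_gt0 => e; exact: fact_gt0.
Qed.

(** Only b = 0 has a nonzero mean against a function of the signal. The factor H_0 = 1 is inserted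
    so that [Ex_hermite2] applies. *)
Lemma Ex_root_hermite a :
  Ex (fun t => v i0 t * H a (fun e => X e t + Z e t)) = mgrootmom ends i0 mu rho a.
Proof.
under eq_fun do rewrite hermite_signal mulr_sumr.
rewrite Ex_sum; last first.
  move=> b; apply: allmomM => //; apply: allmomZ; apply: allmomM => //; exact: mXb.
rewrite (bigD1 [ffun=> ord0])//= [X in _ + X = _]big1 ?addr0 => [|b b0].
  rewrite /mgrootmom.
  transitivity (Ex (fun t => (\prod_e mu e ^+ a e) * ((\prod_(i in mgrootV ends i0 a) v i t) *
       (H [ffun=> ord0] (fun e => Z e t) * H [ffun=> ord0] (fun e => Z e t))))).
    congr (Ex _); apply/funext => t; rewrite !H0 !mulr1 /mgrootV -prod_boolvars big_set1.
    have -> : mgbin a [ffun=> ord0] = 1%N by rewrite /mgbin big1// => e _; rewrite ffunE bin0.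
    rewrite mul1r mulrCA; congr (_ * (_ * _)).
      by apply: eq_bigr => e _; rewrite ffunE subn0.
    rewrite /Xb /mgdiffV; apply: eq_bigl => i; congr (i \in _).
    by rewrite [in RHS](eq_bigl (fun e => ([ffun=> ord0 : 'I_D.+1] e < a e)%N))// => e; rewrite ffunE.
  rewrite ExZ; last by apply: allmomM => //; exact: allmomM.
  rewrite Ex_hermite2 eqxx mulr1n [X in _ * (_ * X)]big1 ?mulr1// => e _.
  by rewrite ffunE.
transitivity (Ex (fun t => ((mgbin a b)%:R * (\prod_e mu e ^+ (a e - b e))) *
      ((\prod_(i in [set i0] :|: mgdiffV ends a b) v i t) *
       (H b (fun e => Z e t) * H [ffun=> ord0] (fun e => Z e t))))).
  by congr (Ex _); apply/funext => t; rewrite H0 mulr1 -prod_boolvars big_set1 /Xb; ring.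
rewrite ExZ; last by apply: allmomM => //; exact: allmomM.
by rewrite Ex_hermite2 (negbTE b0) mulr0.
Qed.

Variable kap : {ffun E -> 'I_D.+1} -> R.
Hypothesis hkap : is_cumulant ends i0 mu rho kap D.

(* the dual witness: E (f(Y) G) = E (f(Y) x) for every f of degree at most D *)
Let G t := \sum_(b | (mgdeg b <= D)%N) kap b / fct b * H b (fun e => Z e t).

Let mG : allmom G.
Proof. by apply: allmom_sum => b; exact: allmomZ. Qed.

(** Orthogonality keeps the term c = b of [G], where the division by b! cancels the norm of H_b; b
    <= a ensures that this term is present in [G]. What remains is the left side of the cumulant
    system. *)
Lemma Ex_hermite_dual a : (mgdeg a <= D)%N ->
  Ex (fun t => H a (fun e => X e t + Z e t) * G t) = mgrootmom ends i0 mu rho a.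
Proof.
move=> aD; rewrite -(hkap aD).
under eq_fun do rewrite hermite_signal mulr_suml.
rewrite Ex_sum; last first.
  by move=> b; apply: allmomM => //; apply: allmomZ; apply: allmomM => //; exact: mXb.
apply: eq_bigr => b _.
have [->|/mgbin_neq0/mgle_deg h] := eqVneq (mgbin a b) 0%N.
  by under eq_fun do rewrite !mul0r; rewrite Ex_cst !mul0r.
have bD := leq_trans h aD.
have -> : (fun t => (mgbin a b)%:R * (\prod_e mu e ^+ (a e - b e)) *
      (Xb a b t * H b (fun e => Z e t)) * G t) =
   (fun t => ((mgbin a b)%:R * (\prod_e mu e ^+ (a e - b e))) *
      \sum_(c | (mgdeg c <= D)%N) kap c / fct c * ((\prod_(i in mgdiffV ends a b) v i t) *
       (H b (fun e => Z e t) * H c (fun e => Z e t)))).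
  apply/funext => t; rewrite -mulrA; congr (_ * _); rewrite /G mulr_sumr.
  by apply: eq_bigr => c _; rewrite /Xb; ring.
have mm c : allmom (fun t => (\prod_(i in mgdiffV ends a b) v i t) *
       (H b (fun e => Z e t) * H c (fun e => Z e t))).
  by apply: allmomM => //; exact: allmomM.
rewrite ExZ; last by apply: allmom_sum => c; exact: allmomZ.
rewrite Ex_sum; last by move=> c; exact: allmomZ.
rewrite (bigD1 b)//= [X in _ + X]big1 ?addr0 => [|c /andP[_ cb]]; last first.
  by rewrite ExZ// Ex_hermite2 eq_sym (negbTE cb) mulr0.
rewrite ExZ// Ex_hermite2 eqxx mulr1n -/(fct b) /mgmom.
have f0 : fct b != 0 by rewrite gt_eqF// (lt_le_trans ltr01).
by field.
Qed.

(** The exact value is the sum of kap b ^ 2 / b!, and the factorials are dropped. The product over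
    the empty set only brings the terms to the form of [Ex_hermite2]. *)
Lemma Ex_dual_sqr : Ex (fun t => G t ^+ 2) <= \sum_(b | (mgdeg b <= D)%N) kap b ^+ 2.
Proof.
have -> : (fun t => G t ^+ 2) = (fun t => \sum_(b | (mgdeg b <= D)%N) \sum_(c | (mgdeg c <= D)%N)
   kap b / fct b * (kap c / fct c) * ((\prod_(i in finset.set0) v i t) * (H b (fun e => Z e t) * H c (fun e => Z e t)))).
  apply/funext => t; rewrite expr2 {1}/G mulr_suml; apply: eq_bigr => b _.
  rewrite mulr_sumr; apply: eq_bigr => c _.
  by rewrite big_set0; ring.
have mm b c : allmom (fun t => (\prod_(i in finset.set0) v i t) *
       (H b (fun e => Z e t) * H c (fun e => Z e t))).
  by apply: allmomM => //; exact: allmomM.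
rewrite Ex_sum; last by move=> b; apply: allmom_sum => c; exact: allmomZ.
apply: ler_sum => b bD.
rewrite Ex_sum; last by move=> c; exact: allmomZ.
rewrite (bigD1 b)//= [X in _ + X]big1 ?addr0 => [|c /andP[_ cb]]; last first.
  by rewrite ExZ// Ex_hermite2 eq_sym (negbTE cb) mulr0.
rewrite ExZ// Ex_hermite2 eqxx mulr1n cards0 expr0 mul1r -/(fct b).
have f0 : 0 < fct b by rewrite (lt_le_trans ltr01).
rewrite (_ : _ * _ = kap b ^+ 2 / fct b); last by field; rewrite gt_eqF.
by rewrite ler_pdivrMr// ler_peMr ?sqr_ge0.
Qed.

Lemma hermite_mmse (f : {ffun E -> 'I_D.+1} -> R) :
  Ex (v i0) - \sum_(b | (mgdeg b <= D)%N) kap b ^+ 2 <=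
  Ex (fun t => (\sum_(a | (mgdeg a <= D)%N) f a * H a (fun e => X e t + Z e t) - v i0 t) ^+ 2).
Proof.
pose F t := \sum_(a | (mgdeg a <= D)%N) f a * H a (fun e => X e t + Z e t).
have mF : allmom F by apply: allmom_sum => a; exact: allmomZ.
have FG : Ex (fun t => F t * G t) = Ex (fun t => v i0 t * F t).
  rewrite /F; under eq_fun do rewrite mulr_suml.
  under [in RHS]eq_fun do rewrite mulr_sumr.
  rewrite !Ex_sum; first last.
  - by move=> a; apply: allmomM => //; exact: allmomZ.
  - by move=> a; apply: allmomM => //; exact: allmomZ.
  apply: eq_bigr => a aD.
  under eq_fun do rewrite -mulrA.
  under [in RHS]eq_fun do rewrite mulrCA.
  by rewrite !ExZ ?Ex_hermite_dual ?Ex_root_hermite//; exact: allmomM.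
have h0 : 0 <= Ex (fun t => (F t - G t) ^+ 2) by apply: Ex_ge0 => t; exact: sqr_ge0.
have E1 : Ex (fun t => (F t - G t) ^+ 2) = Ex (fun t => F t ^+ 2) - 2 * Ex (fun t => F t * G t) + Ex (fun t => G t ^+ 2).
  rewrite -ExZ; last exact: allmomM.
  rewrite -ExB; [|exact: allmomX|by apply: allmomZ; exact: allmomM].
  rewrite -ExD; [|by apply: allmomB; [exact: allmomX|apply: allmomZ; exact: allmomM]|exact: allmomX].
  by congr (Ex _); apply/funext => t; ring.
have E2 : Ex (fun t => (F t - v i0 t) ^+ 2) = Ex (fun t => F t ^+ 2) - 2 * Ex (fun t => v i0 t * F t) + Ex (v i0).
  rewrite -ExZ; last exact: allmomM.
  rewrite -ExB; [|exact: allmomX|by apply: allmomZ; exact: allmomM].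
  rewrite -ExD//; last by apply: allmomB; [exact: allmomX|apply: allmomZ; exact: allmomM].
  congr (Ex _); apply/funext => t.
  have vv : v i0 t ^+ 2 = v i0 t by case: (v01 i0 t) => ->; rewrite ?expr1n ?expr0n.
  transitivity (F t ^+ 2 - 2 * (v i0 t * F t) + v i0 t ^+ 2); last by rewrite vv.
  by rewrite -/(F t); ring.
rewrite E2 -FG; have := Ex_dual_sqr; rewrite E1 in h0; lra.
Qed.
End lower_bound.

(** Each power is expanded on its own; a coefficient is nonzero only when b <= k edge by edge, so
    the total degree does not grow. *)
Lemma hermite_monomial (R : realFieldType) (E : finType) (D : nat) (k : E -> nat) :
  (\sum_e k e <= D)%N ->
  exists f : {ffun E -> 'I_D.+1} -> R, forall z : E -> R,
    \prod_e z e ^+ k e = \sum_(b | (mgdeg b <= D)%N) f b * \prod_e (hermite (b e)).[z e].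
Proof.
move=> kD.
have ke e : (k e <= D)%N by apply: leq_trans kD; rewrite (bigD1 e)//= leq_addr.
have /choice[al hal] : forall e, exists a : nat -> R, (forall j, (k e < j)%N -> a j = 0) /\
   forall x, x ^+ k e = \sum_(j < D.+1) a j * (hermite j).[x].
  by move=> e; exact: hermite_exprn_span.
exists (fun b : {ffun E -> 'I_D.+1} => \prod_e al e (b e)) => z.
under eq_bigr do rewrite (hal _).2.
rewrite bigA_distr_bigA [RHS]big_mkcond; apply: eq_bigr => b _.
rewrite big_split /=; case: ifPn => //; rewrite -ltnNge => lt.
have [e he] : exists e, (k e < b e)%N.
  apply/existsP; apply: contraLR lt => /existsPn h; rewrite -leqNgt.
  by apply: leq_trans kD; apply: leq_sum => e _; rewrite leqNgt.
by rewrite (bigD1 e)//= (hal e).1// !mul0r.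
Qed.

(** * Vertex pairs as edges, and the normalised planted model *)

Section edges.
Variable n : nat.
Definition pedge := {p : 'I_n * 'I_n | (p.1 <= p.2)%N}.

Fact pedge_subproof (u w : 'I_n) :
  let p := if (u <= w)%N then (u, w) else (w, u) in (p.1 <= p.2)%N.
Proof. by case: leqP => //= /ltnW. Qed.

(** Ordering the pair sends the equal entries (u, w) and (w, u) of Y to one primitive noise variable
    of [pidx]. *)
Definition edge_of (u w : 'I_n) : pedge :=
  exist (fun p : 'I_n * 'I_n => (p.1 <= p.2)%N) _ (pedge_subproof u w).

Lemma edge_of_sval (e : pedge) : edge_of (sval e).1 (sval e).2 = e.
Proof. by apply/val_inj; case: e => -[u w] /= ->. Qed.

Lemma edge_of_sym u w : edge_of u w = edge_of w u.
Proof.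
apply/val_inj => /=; case: ltngtP => // uw.
by rewrite (val_inj uw).
Qed.

Lemma edge_of_ends u w :
  [set (sval (edge_of u w)).1; (sval (edge_of u w)).2] = [set u; w].
Proof. by rewrite /=; case: leqP => //= _; rewrite finset.setUC. Qed.

Lemma edge_of_incident (e : pedge) u : u \in [set (sval e).1; (sval e).2] ->
  exists w, edge_of u w = e.
Proof.
rewrite !inE => /orP[/eqP ->|/eqP ->].
  by exists (sval e).2; exact: edge_of_sval.
by exists (sval e).1; rewrite edge_of_sym; exact: edge_of_sval.
Qed.
End edges.

Local Open Scope classical_set_scope.

Section model.
Context (R : realType) (d : measure_display) (T : measurableType d)
  (P : probability T R) (n : nat) (hn : (0 < n)%N) (lambda rho : R)
  (v : 'I_n -> {RV P >-> R}) (W : 'I_n -> 'I_n -> {RV P >-> R}).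
Hypotheses (lambda0 : 0 <= lambda) (rho01 : 0 < rho < 1).
Hypothesis model : planted_submatrix_model rho v W.
Local Notation E := (pedge n).

Definition prim (k : pidx n) : T -> R :=
  match k with inl i => v i | inr e => W (sval e).1 (sval e).2 end.

Let v01 i t : v i t = 0 \/ v i t = 1. Proof. by case: model => h _; exact: h. Qed.

Let Wsym i j t : W i j t = W j i t.
Proof. by case: model => _ [_ [h _]]; exact: h. Qed.

Lemma prim_measurable k : measurable_fun [set: T] (prim k).
Proof. by case: k => [i|e]; exact: measurable_funPT. Qed.

Lemma prim_independent : mutually_independent P prim.
Proof. by case: model => _ [_ [_ [_ [_ h]]]]; exact: h. Qed.

(** Dividing an entry by this makes its noise standard. Being at least 1, it can only lower the
    signal strength, so [lambda] stays an upper bound for all edges. *)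
Definition noise_sd (e : E) : R := if (sval e).1 == (sval e).2 then Num.sqrt 2 else 1.

Lemma noise_sd_ge1 e : 1 <= noise_sd e.
Proof.
rewrite /noise_sd; case: ifP => // _.
by rewrite -[X in X <= _]sqrtr1 ler_sqrt// ler1n.
Qed.

Lemma noise_sd_neq0 e : noise_sd e != 0.
Proof. by rewrite gt_eqF// (lt_le_trans ltr01)// noise_sd_ge1. Qed.

Lemma noise_law e (A : set R) : measurable A ->
  P (prim (inr e) @^-1` A) = normal_prob 0 (noise_sd e) A.
Proof.
case: model => _ [_ [_ [hlt [heq _]]]] mA.
rewrite /noise_sd /=; case: e => -[i j] /= ij.
case: eqP => [<-|/eqP ne]; first exact: heq.
by apply: hlt => //; rewrite ltn_neqAle ij andbT.
Qed.

Lemma prim_allmom k : allmom P (prim k).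
Proof.
case: k => [i|e]; last first.
  exact: (gauss_allmom (noise_sd_neq0 e) (prim_measurable _) (@noise_law e)).
split; first exact: prim_measurable.
move=> k; apply: (@allmom_le _ _ _ P _ (fun=> 1)).
- exact: prim_measurable.
- exact: finite_measure_integrable_cst.
- by move=> t /=; case: (v01 i t) => ->; rewrite ?normr0 ?normr1 ?expr1n ?expr0n//; case: k.
Qed.

Lemma Ex_v i : Ex P (v i) = rho.
Proof.
case: model => _ [hr _].
have m1 : measurable (v i @^-1` [set 1]).
  by rewrite -[_ @^-1` _]setTI; exact: measurable_funPT.
rewrite /Ex /Rintegral; transitivity (fine (\int[P]_t (\1_(v i @^-1` [set 1]) t)%:E)).
  congr fine; apply: eq_integral => t _; congr EFin; rewrite indicE.
  case: (v01 i t) => h; rewrite h.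
    by rewrite memNset//= h => /eqP; rewrite eq_sym oner_eq0.
  by rewrite mem_set.
rewrite (integral_indic _ _ m1)// setIT.
by transitivity (fine rho%:E) => //; congr fine; exact: hr.
Qed.

Definition stdnoise (e : E) (t : T) : R := prim (inr e) t / noise_sd e.

Lemma stdnoise_hermite e j k :
  Ex P (fun t => (hermite j).[stdnoise e t] * (hermite k).[stdnoise e t]) = (j`!)%:R *+ (j == k).
Proof. exact: (gauss_hermite (noise_sd_neq0 e) (prim_measurable _) (@noise_law e)). Qed.

Lemma stdnoise_allmom e : allmom P (stdnoise e).
Proof. by apply: allmomM; [exact: prim_allmom|exact: allmom_cst]. Qed.

Lemma signal_noise_indep (S : {set 'I_n}) (p : E -> {poly R}) :
  Ex P (fun t => (\prod_(i in S) v i t) * \prod_e (p e).[stdnoise e t]) =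
  rho ^+ #|S| * \prod_e Ex P (fun t => (p e).[stdnoise e t]).
Proof.
pose phi (k : pidx n) : R -> R := match k with
  | inl i => if i \in S then id else cst 1
  | inr e => fun w => (p e).[w / noise_sd e] end.
have mphi k : measurable_fun [set: R] (phi k).
  case: k => [i|e] /=; first by case: ifP => _; [exact: measurable_id|exact: measurable_cst].
  have mh : measurable_fun [set: R] (horner (p e)).
    by apply: continuous_measurable_fun; exact: continuous_horner.
  by apply: (measurableT_comp mh); exact: measurable_funM.
have iphi k : P.-integrable [set: T] (fun t => (phi k (prim k t))%:E).
  apply: allmom_int; case: k => [i|e] /=.
    by case: ifP => _; [exact: (prim_allmom (inl i))|exact: allmom_cst].
  by apply: allmom_horner; exact: stdnoise_allmom.
have [_] := integral_indep_prod prim_measurable prim_independent mphi iphi.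
rewrite -/(Ex P _) big_sumType /=.
have -> : (fun t => \prod_k phi k (prim k t)) =
    (fun t => (\prod_(i in S) v i t) * \prod_e (p e).[stdnoise e t]).
  apply/funext => t; rewrite big_sumType /=; congr (_ * _).
  by rewrite [RHS]big_mkcond; apply: eq_bigr => i _; case: ifP.
move=> ->; congr (_ * _).
rewrite -prodr_const [RHS]big_mkcond; apply: eq_bigr => i _; case: ifP => _.
  exact: Ex_v.
exact: Ex_cst.
Qed.

Lemma observationE t i j : observation lambda v W t i j =
  let e := edge_of i j in noise_sd e *
   (lambda / noise_sd e * v (sval e).1 t * v (sval e).2 t + stdnoise e t).
Proof.
set e := edge_of i j; cbv zeta.
have -> : observation lambda v W t i j = lambda * v (sval e).1 t * v (sval e).2 t + W (sval e).1 (sval e).2 t.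
  rewrite /observation /e /=; case: leqP => //= _.
  by rewrite Wsym mulrAC.
by rewrite /stdnoise /=; field; exact: noise_sd_neq0.
Qed.

Let ends (e : E) : {set 'I_n} := finset.setU (finset.set1 (sval e).1) (finset.set1 (sval e).2).
Let i0 := Ordinal hn.
Let mu (e : E) := lambda / noise_sd e.
Let YZ (e : E) t := mu e * v (sval e).1 t * v (sval e).2 t + stdnoise e t.

Lemma poly_eval_hermite D (c : monomial n D -> R) :
  exists f : {ffun E -> 'I_D.+1} -> R, forall t,
   poly_eval c (observation lambda v W t) =
   \sum_(a | (mgdeg a <= D)%N) f a * \prod_e (hermite (a e)).[YZ e t].
Proof.
have H (m : monomial n D) : exists f : {ffun E -> 'I_D.+1} -> R, (mdeg m <= D)%N -> forall t,
   \prod_(ij : 'I_n * 'I_n) observation lambda v W t ij.1 ij.2 ^+ (m ij : nat) =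
   \sum_(a | (mgdeg a <= D)%N) f a * \prod_e (hermite (a e)).[YZ e t].
  have [mD|_] := boolP (mdeg m <= D)%N; last by exists (fun=> 0).
  (* The exponents of the entries (i, j) and (j, i) add up on their common edge; the total degree is
     unchanged. *)
  pose k (e : E) := (\sum_(ij | edge_of ij.1 ij.2 == e) m ij)%N.
  have kD : (\sum_e k e <= D)%N.
    apply: leq_trans mD; rewrite /k /mdeg.
    by rewrite [leqRHS](partition_big (fun ij => edge_of ij.1 ij.2) xpredT).
  have [f hf] := hermite_monomial R kD.
  exists (fun a => (\prod_e noise_sd e ^+ k e) * f a) => _ t.
  have -> : \prod_(ij : 'I_n * 'I_n) observation lambda v W t ij.1 ij.2 ^+ (m ij : nat) =
     \prod_e (noise_sd e * YZ e t) ^+ k e.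
    rewrite (partition_big (fun ij => edge_of ij.1 ij.2) xpredT)//=.
    apply: eq_bigr => e _; rewrite /k -prodrXr.
    by apply: eq_bigr => ij /eqP <-; rewrite observationE.
  under eq_bigr do rewrite exprMn.
  rewrite big_split /= (hf (fun e => YZ e t)) mulr_sumr; apply: eq_bigr => a _.
  by rewrite mulrA.
have /choice[f hf] := H.
exists (fun a => \sum_(m : monomial n D | (mdeg m <= D)%N) c m * f m a) => t.
rewrite /poly_eval.
under [in RHS]eq_bigr do rewrite mulr_suml.
rewrite exchange_big /=; apply: eq_bigr => m mD.
by rewrite hf// mulr_sumr; apply: eq_bigr => a _; rewrite mulrA.
Qed.

Lemma mmse_lower_bound (r : R) (D : nat) : 0 < r < 1 -> (1 <= D)%N ->
  lambda <= r / (D * D.+1)%:R * Num.min 1 (1 / (rho * Num.sqrt n%:R)) ->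
  ((rho - rho ^+ 2 / (1 - r ^+ 2) ^+ 2)%:E <=
    mmse_le P D (observation lambda v W) (v i0))%E.
Proof.
move=> /andP[r0 r1] D1 lamle; have /andP[rho0 rho1] := rho01.
have sn0 : 0 < Num.sqrt n%:R :> R by rewrite sqrtr_gt0 ltr0n.
have DD0 : 0 < (D * D.+1)%:R :> R by rewrite ltr0n muln_gt0 D1.
(* The two members of the minimum in the hypothesis yield the two members of this maximum in
   [lamq]. *)
pose q := Num.max 1 (n%:R * rho ^+ 2).
have q1 : 1 <= q by rewrite le_max lexx.
have lamq : lambda ^+ 2 * q * (D * D.+1)%:R ^+ 2 <= r ^+ 2.
  set s := (D * D.+1)%:R in DD0 *.
  have l1 : lambda * s <= r.
    rewrite -ler_pdivlMr//; apply: le_trans lamle _.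
    by rewrite ler_piMr ?divr_ge0 ?(ltW r0) ?(ltW DD0)// ge_min lexx.
  have l2 : lambda * s * (rho * Num.sqrt n%:R) <= r.
    have rs : 0 < rho * Num.sqrt n%:R by rewrite mulr_gt0.
    have h : lambda <= r / s * (1 / (rho * Num.sqrt n%:R)).
      apply: le_trans lamle _; rewrite ler_wpM2l ?divr_ge0 ?(ltW r0) ?(ltW DD0)//.
      by rewrite ge_min lexx orbT.
    rewrite -mulrA -ler_pdivlMr ?mulr_gt0//; apply: (le_trans h).
    by rewrite div1r -mulrA -invfM lexx.
  have l0 : 0 <= lambda * s by rewrite mulr_ge0// ltW.
  have -> : lambda ^+ 2 * q * s ^+ 2 = (lambda * s) ^+ 2 * q by ring.
  rewrite /q maxr_pMr ?sqr_ge0// ge_max mulr1; apply/andP; split.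
    by apply: lerXn2r; rewrite ?nnegrE// ltW.
  have -> : (lambda * s) ^+ 2 * (n%:R * rho ^+ 2) = (lambda * s * (rho * Num.sqrt n%:R)) ^+ 2.
    by rewrite !exprMn sqr_sqrtr ?ler0n//; ring.
  have l3 : 0 <= lambda * s * (rho * Num.sqrt n%:R) by rewrite mulr_ge0// ltW// mulr_gt0.
  by apply: lerXn2r; rewrite ?nnegrE// ltW.
have [kap hkap] := @cumulant_exists R _ _ D ends i0 mu rho D.
have mu0 e : 0 <= mu e by rewrite divr_ge0// (le_trans ler01)// noise_sd_ge1.
have mulam e : mu e <= lambda.
  by rewrite ler_pdivrMr ?(lt_le_trans ltr01) ?noise_sd_ge1// ler_peMr// noise_sd_ge1.
have ends0 e : ends e != finset.set0 by apply/finset.set0Pn; exists (sval e).1; rewrite !inE eqxx.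
have qU : #|'I_n|%:R * rho ^+ 2 <= q by rewrite card_ord le_max lexx orbT.
have hsum := cumulant_sum (@edge_of_ends n) (@edge_of_incident n) ends0 mu0 mulam rho0 (ltW rho1) r0 r1 lambda0 q1 qU lamq hkap.
apply/ereal_infP => _ [c ->].
have [f hf] := poly_eval_hermite c.
have mv i : allmom P (v i) by exact: (prim_allmom (inl i)).
have := hermite_mmse v01 mv stdnoise_allmom signal_noise_indep stdnoise_hermite hkap f.
rewrite Ex_v => hmm.
under eq_integral do rewrite hf.
rewrite ExE; last first.
  apply: allmomX; apply: allmomB; last exact: mv.
  apply: allmom_sum => a; apply: allmomZ; apply: allmom_prod => e; apply: allmom_horner.
  apply: allmomD; last exact: stdnoise_allmom.
  by apply: allmomM => //; apply: allmomZ.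
rewrite lee_fin; apply: le_trans hmm.
by rewrite lerD2l lerN2.
Qed.
End model.

(** * Upper bound *)

Section polynomial_statistics.
Context {R : realType} (n D : nat).
Implicit Types (F G : ('I_n -> 'I_n -> R) -> R).

(** The total degree is bounded by [k] while the type of monomials keeps the cap [D], so an
    induction can raise the degree without changing the type. *)
Definition is_poly (k : nat) F := exists c : monomial n D -> R, forall Y,
  F Y = \sum_(m : monomial n D | (mdeg m <= k)%N)
     c m * \prod_(ij : 'I_n * 'I_n) Y ij.1 ij.2 ^+ (m ij : nat).

Lemma is_poly_widen k k' F : (k <= k')%N -> is_poly k F -> is_poly k' F.
Proof.
move=> kk' [c hc]; exists (fun m => if (mdeg m <= k)%N then c m else 0) => Y.
rewrite hc [LHS]big_mkcond [RHS]big_mkcond; apply: eq_bigr => m _.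
case: ifP => mk; first by rewrite (leq_trans mk).
by rewrite mul0r; case: ifP.
Qed.

Lemma is_polyD k F G : is_poly k F -> is_poly k G -> is_poly k (fun Y => F Y + G Y).
Proof.
move=> [c hc] [c' hc']; exists (fun m => c m + c' m) => Y.
by rewrite hc hc' -big_split; apply: eq_bigr => m _; rewrite mulrDl.
Qed.

Lemma is_polyZ k a F : is_poly k F -> is_poly k (fun Y => a * F Y).
Proof.
move=> [c hc]; exists (fun m => a * c m) => Y.
by rewrite hc mulr_sumr; apply: eq_bigr => m _; rewrite mulrA.
Qed.

Lemma is_poly_cst k a : is_poly k (fun=> a).
Proof.
pose z : monomial n D := [ffun=> ord0].
exists (fun m => if m == z then a else 0) => Y.
have z0 : (mdeg z <= k)%N by rewrite /mdeg big1// => ij _; rewrite ffunE.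
rewrite (bigD1 z)//= eqxx [X in a * X]big1 => [|ij _]; last by rewrite ffunE expr0.
rewrite mulr1 big1 ?addr0// => m /andP[_ /negbTE ->].
by rewrite mul0r.
Qed.

Lemma is_poly_sum k I (s : seq I) (F : I -> ('I_n -> 'I_n -> R) -> R) :
  (forall i, is_poly k (F i)) -> is_poly k (fun Y => \sum_(i <- s) F i Y).
Proof.
move=> h; elim: s => [|i s IH].
  by under eq_fun do rewrite big_nil; exact: is_poly_cst.
by under eq_fun do rewrite big_cons; exact: is_polyD.
Qed.

(** Multiplication by an entry moves each monomial along [up]. The new coefficient is a sum over
    preimages, which spares inverting [up]; k < D keeps the exponents under the cap. *)
Lemma is_polyM_entry k F i j : (k < D)%N -> is_poly k F ->
  is_poly k.+1 (fun Y => F Y * Y i j).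
Proof.
move=> kD [c hc].
pose up (m : monomial n D) : monomial n D := [ffun ij => inord (m ij + (ij == (i, j)))].
have upE (m : monomial n D) ij : (mdeg m <= k)%N -> up m ij = (m ij + (ij == (i, j)))%N :> nat.
  move=> mk; rewrite ffunE inordK// ltnS; apply: leq_trans kD.
  rewrite -[k.+1]addn1; apply: leq_add; last by case: (_ == _).
  by apply: leq_trans mk; rewrite /mdeg (bigD1 ij)//= leq_addr.
exists (fun m' => \sum_(m : monomial n D | (mdeg m <= k)%N) c m * (m' == up m)%:R) => Y.
rewrite hc mulr_suml.
under [in RHS]eq_bigr do rewrite mulr_suml.
rewrite exchange_big /=; apply: eq_bigr => m mk.
have mup : (mdeg (up m) <= k.+1)%N.
  rewrite /mdeg; under eq_bigr do rewrite upE//.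
  rewrite big_split /= -[k.+1]addn1 leq_add//.
  by rewrite (bigD1 (i, j))//= eqxx big1// => ij /negbTE ->.
rewrite (bigD1 (up m))//= eqxx mulr1 [X in _ + X]big1 ?addr0 => [|m' /andP[_ /negbTE ->]]; last first.
  by rewrite mulr0 mul0r.
rewrite -mulrA; congr (_ * _).
under [in RHS]eq_bigr do rewrite upE// exprD.
rewrite big_split /=; congr (_ * _).
rewrite (bigD1 (i, j))//= eqxx expr1 big1 ?mulr1// => ij /negbTE ->.
by rewrite expr0.
Qed.

Lemma is_poly_linear_form (a : 'I_n -> R) i k : (k <= D)%N ->
  is_poly k (fun Y => (\sum_j a j * Y i j) ^+ k).
Proof.
elim: k => [|k IH] kD; first by under eq_fun do rewrite expr0; exact: is_poly_cst.
under eq_fun do rewrite exprSr mulr_sumr.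
apply: is_poly_sum => j.
have -> : (fun Y : 'I_n -> 'I_n -> R => (\sum_j0 a j0 * Y i j0) ^+ k * (a j * Y i j)) =
   (fun Y => a j * ((\sum_j0 a j0 * Y i j0) ^+ k * Y i j)).
  by apply/funext => Y; rewrite mulrCA.
by apply/is_polyZ/is_polyM_entry => //; apply: IH; exact: ltnW.
Qed.

Lemma poly_eval_linear_form (a : 'I_n -> R) i (p : {poly R}) : (size p <= D.+1)%N ->
  exists c : monomial n D -> R, forall Y, p.[\sum_j a j * Y i j] = poly_eval c Y.
Proof.
move=> sp.
suff [c hc] : is_poly D (fun Y => p.[\sum_j a j * Y i j]) by exists c.
under eq_fun do rewrite horner_coef.
rewrite (_ : (fun Y => _) = fun Y : 'I_n -> 'I_n -> R => \sum_(k <- enum 'I_(size p)) p`_k * (\sum_j a j * Y i j) ^+ k); last first.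
  by apply/funext => Y; rewrite big_enum.
apply: is_poly_sum => k; apply: is_polyZ.
have kD : (k <= D)%N by rewrite -ltnS (leq_trans (ltn_ord k)).
by apply: (is_poly_widen kD); exact: is_poly_linear_form.
Qed.
End polynomial_statistics.

(** * A polynomial flat at 0 and at 1 *)

Section smoothstep.
Context {R : realType} (k : nat).
Local Notation D := k.*2.+1.

(* The upper half of the binomial expansion of (X + (1 - X))^D: it vanishes to
   order k + 1 at 0, and by symmetry 1 minus it vanishes to order k + 1 at 1. *)
Definition smoothstep : {poly R} :=
  \sum_(j < D.+1 | (k < j)%N) 'C(D, j)%:R *: ('X ^+ j * (1 - 'X) ^+ (D - j)).

Lemma size_smoothstep : (size smoothstep <= D.+1)%N.
Proof.
apply: (leq_trans (size_sum _ _ _)); apply/bigmax_leqP => j _.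
apply: (leq_trans (size_scale_leq _ _)).
apply: (leq_trans (size_polyMleq _ _)).
rewrite size_polyXn addSn /=.
have h : (size ((1 - 'X : {poly R}) ^+ (D - j)) <= (D - j).+1)%N.
  apply: (leq_trans (size_poly_exp_leq _ _)).
  have -> : size (1 - 'X : {poly R}) = 2%N.
    by rewrite -opprB size_polyN size_XsubC.
  by rewrite mul1n.
apply: (leq_trans (leq_add (leqnn j) h)).
by rewrite addnS subnKC// -ltnS.
Qed.

Lemma smoothstepE t : smoothstep.[t] =
  \sum_(j < D.+1 | (k < j)%N) 'C(D, j)%:R * (t ^+ j * (1 - t) ^+ (D - j)).
Proof.
rewrite /smoothstep horner_sum; apply: eq_bigr => j _.
by rewrite hornerZ hornerM !horner_exp hornerX hornerD hornerN hornerX hornerC.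
Qed.

(** The odd degree gives an even number of binomial terms; the lower half, read backwards, is the
    upper half at 1 - t. *)
Lemma smoothstep_sym t : 1 - smoothstep.[t] = smoothstep.[1 - t].
Proof.
apply/eqP; rewrite subr_eq; apply/eqP.
have H : \sum_(j < D.+1) 'C(D, j)%:R * (t ^+ j * (1 - t) ^+ (D - j)) = 1.
  rewrite -[RHS](expr1n _ D) -[X in _ = X ^+ _](subrK t 1) exprDn.
  by apply: eq_bigr => j _; rewrite mulr_natl [(1 - t) ^+ _ * _]mulrC.
rewrite -[LHS]H.
rewrite (bigID (fun j : 'I_D.+1 => (k < j)%N))/= addrC -smoothstepE; congr (_ + _).
rewrite smoothstepE (reindex_inj rev_ord_inj) /=.
apply: eq_big => [j|j _].
  by rewrite subSS; lia.
have jD : (j <= D)%N by rewrite -ltnS.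
have e : 1 - (1 - t) = t by ring.
rewrite subSS bin_sub// subKn// e.
by rewrite [(1 - t) ^+ _ * _]mulrC.
Qed.

(** Every term has j >= k + 1, so |t|^(k+1) comes out and k factors at most 1 + |t| remain; the
    binomials sum to at most 2^D = 2 4^k. *)
Lemma smoothstep_bound t :
  `|smoothstep.[t]| <= 2 * 4 ^+ k * (`|t| ^+ k.+1 * (1 + `|t|) ^+ k).
Proof.
rewrite smoothstepE; apply: (le_trans (ler_norm_sum _ _ _)).
have t0 := normr_ge0 t.
apply: (@le_trans _ _ (\sum_(j < D.+1 | (k < j)%N) 'C(D, j)%:R * (`|t| ^+ k.+1 * (1 + `|t|) ^+ k))).
  apply: ler_sum => j kj; rewrite normrM normr_nat ler_wpM2l// normrM !normrX.
  have jD : (j <= D)%N by rewrite -ltnS.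
  rewrite -{1}(subnKC kj) exprD -mulrA ler_wpM2l ?exprn_ge0//.
  have -> : (1 + `|t|) ^+ k = (1 + `|t|) ^+ (j - k.+1) * (1 + `|t|) ^+ (D - j).
    by rewrite -exprD; congr (_ ^+ _); lia.
  apply: ler_pM; rewrite ?exprn_ge0//.
    by apply: lerXn2r; rewrite ?nnegrE ?addr_ge0// lerDr.
  apply: lerXn2r; rewrite ?nnegrE ?addr_ge0//.
  by apply: (le_trans (ler_normB _ _)); rewrite normr1.
rewrite -mulr_suml ler_wpM2r ?mulr_ge0 ?exprn_ge0 ?addr_ge0//.
apply: (@le_trans _ _ (\sum_(j < D.+1) 'C(D, j)%:R)).
  by rewrite [leLHS]big_mkcond; apply: ler_sum => j _; case: ifP.
rewrite -natr_sum (_ : \sum_(j < D.+1) 'C(D, j) = 2 ^ D)%N; last first.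
  by rewrite -[2%N]/(1 + 1)%N expnDn; apply: eq_bigr => j _; rewrite !exp1n !muln1.
by rewrite natrX exprS -mul2n exprM (_ : 2 ^+ 2 = 4 :> R)//; ring.
Qed.

(** Here (1 + |t|)^(2k) <= 4^k (1 + |t|^(2k)), which turns 16^k into 64^k and leaves only two even
    powers of t. *)
Lemma smoothstep_sqr_bound t :
  smoothstep.[t] ^+ 2 <= 4 * 64 ^+ k * (t ^+ (2 * k.+1) + t ^+ (2 * D)).
Proof.
have t0 := normr_ge0 t.
rewrite -[leLHS]real_normK ?num_real//.
apply: (@le_trans _ _ ((2 * 4 ^+ k * (`|t| ^+ k.+1 * (1 + `|t|) ^+ k)) ^+ 2)).
  by apply: lerXn2r; rewrite ?nnegrE// ?smoothstep_bound// !mulr_ge0// ?exprn_ge0 ?addr_ge0.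
have e2 j : t ^+ (2 * j) = `|t| ^+ (2 * j).
  by rewrite !exprM real_normK ?num_real.
rewrite !e2; set x := `|t|.
have -> : (2 * 4 ^+ k * (x ^+ k.+1 * (1 + x) ^+ k)) ^+ 2 =
    4 * (16 ^+ k) * x ^+ (2 * k.+1) * (1 + x) ^+ (2 * k).
  rewrite !exprMn -!exprM ![(2 * _)%N]mulnC (_ : 16 = 4 ^+ 2 :> R); last by ring.
  by rewrite -[(4 ^+ 2) ^+ k]exprM [(2 * k)%N]mulnC; ring.
have h := @exprD_le R 1 x (2 * k) ler01 t0.
have x0 : 0 <= x ^+ (2 * k.+1) by rewrite exprn_ge0.
apply: (le_trans (ler_wpM2l _ h)); first by rewrite !mulr_ge0 ?exprn_ge0.
rewrite expr1n [2 ^+ (2 * k)]exprM (_ : 2 ^+ 2 = 4 :> R); last by ring.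
rewrite (_ : 2 * D = 2 * k.+1 + 2 * k)%N; last by lia.
rewrite exprD (_ : 64 = 16 * 4 :> R); last by ring.
by rewrite exprMn le_eqVlt; apply/orP; left; apply/eqP; ring.
Qed.

Lemma smoothstep_error t b : b = 0 \/ b = 1 ->
  (smoothstep.[t] - b) ^+ 2 <= 4 * 64 ^+ k * ((t - b) ^+ (2 * k.+1) + (t - b) ^+ (2 * D)).
Proof.
case=> ->; first by rewrite !subr0; exact: smoothstep_sqr_bound.
rewrite -sqrrN opprB smoothstep_sym; apply: (le_trans (smoothstep_sqr_bound _)).
by rewrite -opprB ![(- _) ^+ (2 * _)]exprM sqrrN -!exprM.
Qed.
End smoothstep.

(** * Numerical constants *)

Section numerics.
Context {R : realType}.

Lemma expR_le_inv (x : R) : x < 1 -> expR x <= (1 - x)^-1.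
Proof.
move=> x1; rewrite -[x in expR x]opprK expRN lef_pV2 ?posrE ?expR_gt0 ?subr_gt0//.
exact: expR_ge1Dx.
Qed.

(** e is the tenth power of e^(1/10) <= 10/9, and (10/9)^10 < 3. *)
Lemma expR1_le3 : expR 1 <= 3 :> R.
Proof.
have -> : (1 : R) = 10%:R * (1 / 10) by lra.
rewrite expRM_natl.
have h : expR (1 / 10) <= 10 / 9 :> R.
  apply: (le_trans (expR_le_inv _)); first lra.
  rewrite (_ : 1 - 1 / 10 = 9 / 10 :> R); last by lra.
  by rewrite invf_div.
apply: (@le_trans _ _ ((10 / 9) ^+ 10)).
  by apply: lerXn2r; rewrite ?nnegrE ?expR_ge0//; lra.
by rewrite !exprS expr0; lra.
Qed.

Lemma expR_nat_le (m : nat) : expR m%:R <= 3 ^+ m :> R.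
Proof.
rewrite -[m%:R]mulr1 expRM_natl.
by apply: lerXn2r; rewrite ?nnegrE ?expR_ge0// expR1_le3.
Qed.

(** 18 is the value of 9 / rho at rho = 1/2. The proof compares squares: e^5 <= 3^5 = 243 < 324 =
    18^2. *)
Lemma ln18_ge : 5 / 2 <= ln 18 :> R.
Proof.
rewrite -[leLHS]expRK ler_ln ?posrE ?expR_gt0//.
rewrite -(@ler_pXn2r _ 2)// ?nnegrE ?expR_ge0// -expRM_natl.
rewrite (_ : 2%:R * (5 / 2) = 5%:R :> R); last by lra.
by apply: (le_trans (expR_nat_le 5)); rewrite !exprS expr0; lra.
Qed.

(** Bernoulli's inequality (1 + 1/m)^j >= 1 + j/m with denominators cleared. *)
Lemma expn_bernoulli m j : (m ^ j * (m + j) <= m.+1 ^ j * m)%N.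
Proof.
elim: j => [|j IH]; first by rewrite !expn0 addn0.
rewrite !expnS -mulnA; apply: (@leq_trans (m.+1 * (m ^ j * (m + j)))); last first.
  by rewrite -mulnA leq_mul2l IH orbT.
rewrite mulnCA [X in (_ <= X)%N]mulnCA leq_mul2l; apply/orP; right.
by rewrite -addSnnS; nia.
Qed.

(** Passing from m to m + 1 multiplies the factorial by at most 4 (m+1)^2, and 2 m^m <= (m+1)^m,
    squared, pays for the 4. *)
Lemma fact_double_le m : ((2 * m)`! <= 2 * m ^ (2 * m))%N.
Proof.
elim: m => // -[_|m IH]; first by [].
have h : (2 * m.+1 ^ m.+1 <= m.+2 ^ m.+1)%N.
  have := expn_bernoulli m.+1 m.+1; rewrite addnn -mul2n mulnA leq_pmul2r//.
  by rewrite mulnC.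
have h2 : (4 * m.+1 ^ (2 * m.+1) <= m.+2 ^ (2 * m.+1))%N.
  rewrite [(2 * m.+1)%N]mulnC !expnM.
  by have := leq_mul h h; rewrite !expnS !expn0; nia.
rewrite (_ : 2 * m.+2 = (2 * m.+1).+2)%N; last by lia.
rewrite !factS (expnS m.+2 (2 * m.+1).+1) (expnS m.+2 (2 * m.+1)) mulnA.
have c : ((2 * m.+1).+2 * (2 * m.+1).+1 <= 4 * (m.+2 * m.+2))%N by nia.
apply: (leq_trans (leq_mul c IH)).
rewrite [leqLHS](_ : _ = 2 * (m.+2 * m.+2) * (4 * m.+1 ^ (2 * m.+1)))%N; last by ring.
apply: (leq_trans (leq_mul (leqnn _) h2)). by rewrite !mulnA.
Qed.
End numerics.

(** * Moments from exponential moments *)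

Section mgf.
Context d (T : measurableType d) (R : realType) (P : probability T R).

(** Apply y^(2m) <= (2m)! (e^y + e^(-y)) at y = s Q, then (2m)! <= 2 m^(2m). In each use s is tuned
    so that the exponential moments are at most e^m. *)
Lemma moment_of_mgf (Q : T -> R) (s : R) m : allmom P Q -> 0 < s ->
  (\int[P]_t (expR (s * Q t))%:E <= (3 ^+ m)%:E)%E ->
  (\int[P]_t (expR (- s * Q t))%:E <= (3 ^+ m)%:E)%E ->
  Ex P (fun t => Q t ^+ (2 * m)) <= 4 * (3 * m%:R ^+ 2 / s ^+ 2) ^+ m.
Proof.
move=> mQ s0 h1 h2.
have [mQ0 _] := mQ.
have mexp a : measurable_fun [set: T] (fun t => (expR (a * Q t))%:E).
  by apply/measurable_EFinP; apply: measurableT_comp => //; exact: measurable_funM.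
pose c : R := (2 * m)`!%:R / s ^+ (2 * m).
have sm0 : 0 < s ^+ (2 * m) by rewrite exprn_gt0.
have c0 : 0 <= c by rewrite divr_ge0// ltW.
rewrite -lee_fin -ExE; last exact: allmomX.
apply: (@le_trans _ _ (\int[P]_t (c%:E * ((expR (s * Q t))%:E + (expR (- s * Q t))%:E)))%E).
  apply: ge0_le_integral => //.
  - by move=> t _; rewrite lee_fin exprM exprn_ge0// sqr_ge0.
  - by apply/measurable_EFinP; exact: measurable_funX.
  - by apply: measurable_funeM; exact: emeasurable_funD.
  - move=> t _; rewrite -EFinD -EFinM lee_fin /c mulrAC ler_pdivlMr// mulrC -exprMn.
    rewrite (_ : (s * Q t) ^+ (2 * m) = `|s * Q t| ^+ (2 * m)); last first.
      by rewrite !exprM real_normK ?num_real.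
    by have := normr_exprn_le (2 * m) (s * Q t); rewrite mul1r mulN1r mulNr.
rewrite ge0_integralZl//; [|by apply: emeasurable_funD|by move=> t _; rewrite -EFinD lee_fin addr_ge0 ?expR_ge0].
rewrite ge0_integralD//; try by move=> t _; rewrite lee_fin expR_ge0.
apply: (@le_trans _ _ (c%:E * ((3 ^+ m)%:E + (3 ^+ m)%:E))%E).
  by rewrite lee_wpmul2l ?lee_fin// leeD.
rewrite -EFinD -EFinM lee_fin /c.
have fm : (2 * m)`!%:R <= 2 * m%:R ^+ (2 * m) :> R.
  by rewrite -natrX -natrM ler_nat fact_double_le.
apply: (@le_trans _ _ (2 * m%:R ^+ (2 * m) / s ^+ (2 * m) * (3 ^+ m + 3 ^+ m))).
  by rewrite ler_wpM2r ?addr_ge0 ?exprn_ge0// ler_wpM2r// invr_ge0 ltW.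
rewrite expr_div_n exprMn -!exprM le_eqVlt; apply/orP; left; apply/eqP.
by field; rewrite expf_neq0// gt_eqF.
Qed.

Variables (K : finType) (X : K -> T -> R).
Hypothesis mX : forall k, measurable_fun [set: T] (X k).
Hypothesis iX : mutually_independent P X.

Lemma mgf_indep_sum (S : {set K}) (c M : K -> R) s :
  (forall k, k \in S -> (\int[P]_t (expR (s * (X k t - c k)))%:E = (M k)%:E)%E) ->
  (\int[P]_t (expR (s * \sum_(k in S) (X k t - c k)))%:E = (\prod_(k in S) M k)%:E)%E.
Proof.
move=> hM.
pose phi k : R -> R := if k \in S then (fun w => expR (s * (w - c k))) else cst 1.
pose e k := if k \in S then M k else 1.
have mphi k : measurable_fun [set: R] (phi k).
  rewrite /phi; case: ifP => _; last exact: measurable_cst.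
  by apply: measurableT_comp => //; apply: measurable_funM => //; exact: measurable_funB.
have phi0 k x : 0 <= phi k x by rewrite /phi; case: ifP => _; rewrite ?expR_ge0.
have he k : (\int[P]_t (phi k (X k t))%:E = (e k)%:E)%E.
  rewrite /phi /e; case: ifP => kS; first exact: hM.
  transitivity (\int[P]_(t in [set: T]) (cst (1 : R)%:E t))%E => //.
  by rewrite integral_cst// [X in (_ * X)%E](probability_setT P) mule1.
have := ge0_integral_indep_prod mX iX mphi phi0 he.
rewrite -big_mkcond => <-; apply: eq_integral => t _; congr EFin.
rewrite mulr_sumr expR_sum big_mkcond; apply: eq_bigr => k _.
by rewrite /phi; case: ifP.
Qed.
End mgf.

(** * The corner statistic and the row statistic *)

Section upper_bound.
Context (R : realType) (d : measure_display) (T : measurableType d)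
  (P : probability T R) (n : nat) (hn : (0 < n)%N) (lambda rho : R)
  (v : 'I_n -> {RV P >-> R}) (W : 'I_n -> 'I_n -> {RV P >-> R}).
Hypotheses (lambda0 : 0 <= lambda) (rho01 : 0 < rho < 1).
Hypothesis model : planted_submatrix_model rho v W.
Let i0 := Ordinal hn.
Local Notation prim := (prim v W).
Local Notation Y := (observation lambda v W).

Let v01 i t : v i t = 0 \/ v i t = 1. Proof. by case: model => h _; exact: h. Qed.

Let mv i : allmom P (v i). Proof. exact: (prim_allmom model (inl i)). Qed.

Let mW i j : allmom P (W i j).
Proof.
have := prim_allmom model (inr (edge_of i j)); rewrite /=.
case: leqP => //= _.
by rewrite (_ : (W j i : T -> R) = W i j)//; apply/funext => t; case: model => _ [_ [h _]]; rewrite h.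
Qed.

Lemma observation_allmom i j : allmom P (fun t => Y t i j).
Proof. by apply: allmomD => //; apply: allmomM => //; exact: allmomZ. Qed.

(** The estimator is [smoothstep] of the statistic. Its mean square error is at most 4 64^k times
    the sum of two moments, each at most 8 (r^2/64)^(k+1); the constants cancel exactly and leave
    r^(2k+2). *)
Lemma mmse_upper_of_moments k (a : 'I_n -> R) r :
  0 < r < 1 ->
  (forall m, (0 < m <= k.*2.+1)%N ->
    Ex P (fun t => (\sum_j a j * Y t i0 j - v i0 t) ^+ (2 * m)) <= 8 * (r ^+ 2 / 64) ^+ m) ->
  (mmse_le P k.*2.+1 Y (v i0) <= (((k.*2.+1) ^ 2)%:R * r ^+ k.*2)%:E)%E.
Proof.
move=> /andP[r0 r1] hm; set D := k.*2.+1.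
have [c hc] := @poly_eval_linear_form R n D a i0 (smoothstep k) (size_smoothstep k).
apply: ge_ereal_inf.
exists (\int[P]_t ((poly_eval c (Y t) - v i0 t) ^+ 2)%:E)%E; first by exists c.
pose xi t := \sum_j a j * Y t i0 j - v i0 t.
have mlin : allmom P (fun t => \sum_j a j * Y t i0 j).
  by apply: allmom_sum => j; apply: allmomZ; exact: observation_allmom.
have mxi : allmom P xi by exact: allmomB.
have msq : allmom P (fun t => ((smoothstep k).[\sum_j a j * Y t i0 j] - v i0 t) ^+ 2).
  by apply: allmomX; apply: allmomB => //; exact: allmom_horner.
under eq_integral do rewrite -hc.
rewrite ExE// lee_fin.
apply: (@le_trans _ _ (4 * 64 ^+ k * (Ex P (fun t => xi t ^+ (2 * k.+1)) + Ex P (fun t => xi t ^+ (2 * D))))).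
  rewrite -ExD; [|exact: allmomX|exact: allmomX].
  rewrite -ExZ; last by apply: allmomD; exact: allmomX.
  apply: le_Ex => //; last by move=> t; apply: smoothstep_error; case: (v01 i0 t); auto.
  by apply: allmomZ; apply: allmomD; exact: allmomX.
have k1 : (0 < k.+1 <= D)%N by rewrite /D; lia.
have k2 : (0 < D <= D)%N by rewrite leqnn.
have c0 : 0 <= 4 * 64 ^+ k :> R by rewrite mulr_ge0// exprn_ge0.
apply: (le_trans (ler_wpM2l c0 (lerD (hm _ k1) (hm _ k2)))).
set q := r ^+ 2 / 64.
have q0 : 0 <= q by rewrite divr_ge0 ?sqr_ge0.
have r21 : r ^+ 2 < 1 by rewrite expr_lt1// ltW.
have q1 : q <= 1 by rewrite /q; lra.
have hq : q ^+ D <= q ^+ k.+1.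
  by apply: ler_wiXn2l => //; case/andP: k1.
apply: (@le_trans _ _ (4 * 64 ^+ k * (8 * q ^+ k.+1 + 8 * q ^+ k.+1))).
  by rewrite ler_wpM2l// lerD2l ler_wpM2l.
have -> : 4 * 64 ^+ k * (8 * q ^+ k.+1 + 8 * q ^+ k.+1) = (r ^+ 2) ^+ k * r ^+ 2.
  rewrite [q ^+ k.+1]exprS /q expr_div_n.
  by field; rewrite expf_neq0// pnatr_eq0.
rewrite -exprM mul2n.
have rk : 0 <= r ^+ k.*2 by rewrite exprn_ge0// ltW.
rewrite mulrC ler_wpM2r//.
by apply: (le_trans (ltW r21)); rewrite ler1n expn_gt0.
Qed.

Let J : {set 'I_n} := finset.setC (finset.set1 i0).
Let N := n.-1.
Let cardJ : #|J| = N.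
Proof. by rewrite cardsC1 card_ord. Qed.

Lemma row_noise_mgf s :
  (\int[P]_t (expR (s * \sum_(j in J) W i0 j t))%:E = (expR (N%:R * (s ^+ 2 / 2)))%:E)%E.
Proof.
pose S : {set pidx n} := [set inr (edge_of i0 j) | j in J]%SET.
(* The root is the least index, so the pair is already in order. *)
have edgeE j : sval (edge_of i0 j) = (i0, j) by [].
have inj : {in J &, injective (fun j => inr (edge_of i0 j) : pidx n)}.
  move=> j j' _ _ /(congr1 (fun k : pidx n => if k is inr e then (sval e).2 else i0)).
  by rewrite !edgeE.
have := @mgf_indep_sum _ _ _ P _ prim (prim_measurable v W) (prim_independent model) S
  (fun=> 0) (fun=> expR (s ^+ 2 / 2)) s.
rewrite prodr_const card_in_imset// cardJ -expRM_natl => <-.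
  apply: eq_integral => t _; congr (expR (_ * _))%:E.
  by rewrite big_imset//=; apply: eq_bigr => j _; rewrite subr0.
move=> k /imsetP[j jJ ->].
have -> : s ^+ 2 / 2 = s ^+ 2 * noise_sd R (edge_of i0 j) ^+ 2 / 2.
  rewrite /noise_sd edgeE /= ifN ?expr1n ?mulr1//.
  by move: jJ; rewrite !inE eq_sym.
rewrite -(gauss_mgf (noise_sd_neq0 R _) (prim_measurable v W _) (@noise_law _ _ _ _ _ _ _ _ model _)).
by apply: eq_integral => t _; rewrite subr0.
Qed.

Lemma row_noise_moment m : (0 < N)%N -> (0 < m)%N ->
  Ex P (fun t => (\sum_(j in J) W i0 j t) ^+ (2 * m)) <= 4 * (3 / 2 * m%:R * N%:R) ^+ m.
Proof.
move=> N0 m0.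
have N0' : 0 < N%:R :> R by rewrite ltr0n.
have m0' : 0 < m%:R :> R by rewrite ltr0n.
(* with this s the exponential moment is e^m, which is at most 3^m *)
pose s : R := Num.sqrt (2 * m%:R / N%:R).
have ss : s ^+ 2 = 2 * m%:R / N%:R by rewrite sqr_sqrtr// divr_ge0// mulr_ge0.
have s0 : 0 < s by rewrite sqrtr_gt0 divr_gt0// mulr_gt0.
have -> : 3 / 2 * m%:R * N%:R = 3 * m%:R ^+ 2 / s ^+ 2 :> R.
  by rewrite ss; field; rewrite !gt_eqF.
have E : N%:R * (s ^+ 2 / 2) = m%:R by rewrite ss; field; rewrite gt_eqF.
apply: moment_of_mgf => //.
- exact: allmom_sum.
- by rewrite row_noise_mgf E lee_fin expR_nat_le.
- by rewrite row_noise_mgf sqrrN E lee_fin expR_nat_le.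
Qed.

Lemma corner_noise_moment m : (0 < m)%N ->
  Ex P (fun t => W i0 i0 t ^+ (2 * m)) <= 4 * (3 * m%:R) ^+ m.
Proof.
move=> m0; have m0' : 0 < m%:R :> R by rewrite ltr0n.
(* The corner noise has variance 2, so its exponential moment at s is exp(s^2) = e^m. *)
pose s : R := Num.sqrt m%:R.
have ss : s ^+ 2 = m%:R by rewrite sqr_sqrtr// ler0n.
have s0 : 0 < s by rewrite sqrtr_gt0.
have -> : 3 * m%:R = 3 * m%:R ^+ 2 / s ^+ 2 :> R by rewrite ss; field; rewrite gt_eqF.
have mgf a : (\int[P]_t (expR (a * W i0 i0 t))%:E = (expR (a ^+ 2))%:E)%E.
  have := gauss_mgf (noise_sd_neq0 R _) (prim_measurable v W _) (@noise_law _ _ _ _ _ _ _ _ model (edge_of i0 i0)) a.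
  rewrite /noise_sd /= ?eqxx sqr_sqrtr//.
  by move=> ->; congr (expR _)%:E; field.
apply: moment_of_mgf => //.
- by rewrite mgf ss lee_fin expR_nat_le.
- by rewrite mgf sqrrN ss lee_fin expR_nat_le.
Qed.

(** By 1 + u <= e^u a centred Bernoulli variable has exponential moment at most exp(rho (e^s - 1 -
    s)), and e^s - 1 - s <= 3 s^2 / 2 in this range. *)
Lemma row_size_mgf s : -1/3 <= s <= 1/3 ->
  (\int[P]_t (expR (s * \sum_(j in J) (v j t - rho)))%:E <= (expR (N%:R * (3 / 2 * rho * s ^+ 2)))%:E)%E.
Proof.
move=> /andP[s1 s2]; have /andP[rho0 rho1] := rho01.
pose S : {set pidx n} := [set inl j | j in J]%SET.
have inj : {in J &, injective (fun j => inl j : pidx n)} by move=> j j' _ _ [].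
pose M : R := expR (- s * rho) * (1 + rho * (expR s - 1)).
have := @mgf_indep_sum _ _ _ P _ prim (prim_measurable v W) (prim_independent model) S
  (fun=> rho) (fun=> M) s.
rewrite prodr_const card_in_imset// cardJ => H.
have -> : (\int[P]_t (expR (s * \sum_(j in J) (v j t - rho)))%:E = (M ^+ N)%:E)%E.
  rewrite -H.
    by apply: eq_integral => t _; congr (expR (_ * _))%:E; rewrite big_imset.
  move=> k /imsetP[j jJ ->].
  transitivity (\int[P]_t (expR (- s * rho) * (1 + (expR s - 1) * v j t))%:E)%E.
    apply: eq_integral => t _; congr EFin.
    rewrite mulrBr expRD -mulNr mulrC; congr (_ * _); rewrite /=.
    by case: (v01 j t) => ->; rewrite ?mulr0 ?mulr1 ?expR0; ring.
  rewrite ExE; last first.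
    by apply: allmomZ; apply: allmomD; [exact: allmom_cst|exact: allmomZ].
  rewrite ExZ ?ExD ?ExZ ?Ex_cst ?(Ex_v model)//; last first.
  - by apply: allmomD; [exact: allmom_cst|exact: allmomZ].
  - exact: allmomZ.
  - exact: allmom_cst.
  by rewrite /M [rho * _]mulrC.
rewrite lee_fin expRM_natl; apply: lerXn2r; rewrite ?nnegrE ?expR_ge0//.
  rewrite mulr_ge0 ?expR_ge0//.
  have := expR_ge0 s; nra.
(* From e^s <= 1 / (1 - s): the product (1 - s)(1 + s + 3 s^2 / 2) exceeds 1 by s^2 (1 - 3 s) / 2,
   which is nonnegative as s <= 1/3. *)
have h1 : expR s <= 1 + s + 3 / 2 * s ^+ 2.
  apply: (le_trans (expR_le_inv _)); first lra.
  rewrite -[leLHS]mul1r ler_pdivrMr; last by lra.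
  have : 0 <= s ^+ 2 * (1 / 2 - 3 / 2 * s) by rewrite mulr_ge0 ?sqr_ge0//; lra.
  lra.
rewrite /M; apply: (@le_trans _ _ (expR (- s * rho) * expR (rho * (expR s - 1)))).
  by rewrite ler_wpM2l ?expR_ge0// expR_ge1Dx.
rewrite -expRD ler_expR; nra.
Qed.

Lemma row_size_moment m : (0 < m)%N -> 6 * m%:R <= N%:R * rho ->
  Ex P (fun t => (\sum_(j in J) (v j t - rho)) ^+ (2 * m)) <= 4 * (9 / 2 * m%:R * (N%:R * rho)) ^+ m.
Proof.
move=> m0 h; have /andP[rho0 rho1] := rho01.
have m0' : 0 < m%:R :> R by rewrite ltr0n.
have p0 : 0 < N%:R * rho by apply: lt_le_trans h; rewrite mulr_gt0.
have [N0 rho0'] : N%:R != 0 :> R /\ rho != 0.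
  by split; [apply: contraTneq p0 => ->; rewrite mul0r ltxx|rewrite gt_eqF].
(* This value makes the exponent in [row_size_mgf] equal to m; the hypothesis 6 m <= N rho says that
   s <= 1/3. *)
pose s : R := Num.sqrt (m%:R / (3 / 2 * (N%:R * rho))).
have q0 : 0 < m%:R / (3 / 2 * (N%:R * rho)) by rewrite divr_gt0// mulr_gt0.
have ss : s ^+ 2 = m%:R / (3 / 2 * (N%:R * rho)) by rewrite sqr_sqrtr// ltW.
have s0 : 0 < s by rewrite sqrtr_gt0.
have -> : 9 / 2 * m%:R * (N%:R * rho) = 3 * m%:R ^+ 2 / s ^+ 2 :> R.
  by rewrite ss; field; rewrite rho0' N0 gt_eqF.
have E : N%:R * (3 / 2 * rho * s ^+ 2) = m%:R.
  by rewrite ss; field; rewrite rho0' N0.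
have s3 : s <= 1 / 3.
  rewrite -(@ler_pXn2r _ 2)// ?nnegrE ?(ltW s0) ?divr_ge0//.
  rewrite ss ler_pdivrMr; [lra|by rewrite mulr_gt0].
have sa : -1/3 <= s <= 1/3 by apply/andP; split; lra.
have sb : -1/3 <= - s <= 1/3 by apply/andP; split; lra.
apply: moment_of_mgf => //.
- by apply: allmom_sum => j; apply: allmomB => //; exact: allmom_cst.
- by apply: (le_trans (row_size_mgf sa)); rewrite E lee_fin expR_nat_le.
- by apply: (le_trans (row_size_mgf sb)); rewrite sqrrN E lee_fin expR_nat_le.
Qed.

(** As v_1^2 = v_1, the error is W_11 / lambda. The constant is 192 = 3 64, with the 3 of
    [corner_noise_moment]. *)
Lemma corner_statistic_moment r m : 0 < lambda -> (0 < m)%N ->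
  192 * m%:R <= lambda ^+ 2 * r ^+ 2 ->
  Ex P (fun t => (\sum_j (if j == i0 then lambda^-1 else 0) * Y t i0 j - v i0 t) ^+ (2 * m)) <=
  8 * (r ^+ 2 / 64) ^+ m.
Proof.
move=> l0 m0 h.
have -> : (fun t => (\sum_j (if j == i0 then lambda^-1 else 0) * Y t i0 j - v i0 t) ^+ (2 * m)) =
    (fun t => lambda ^- (2 * m) * W i0 i0 t ^+ (2 * m)).
  apply/funext => t; rewrite -exprVn -exprMn; congr (_ ^+ _).
  rewrite (bigD1 i0)//= ?eqxx big1 => [|j /negbTE ->]; last by rewrite mul0r.
  have vv : v i0 t * v i0 t = v i0 t by case: (v01 i0 t) => ->; rewrite ?mulr0 ?mulr1.
  by rewrite /observation -mulrA vv addr0 mulrDr mulrA mulVf ?gt_eqF// mul1r addrAC subrr add0r.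
rewrite ExZ; last exact: allmomX.
apply: (@le_trans _ _ (lambda ^- (2 * m) * (4 * (3 * m%:R) ^+ m))).
  by rewrite ler_wpM2l ?corner_noise_moment// invr_ge0 exprn_ge0// ltW.
rewrite mulrCA exprM -exprVn -exprMn.
have l2 : 0 < lambda ^+ 2 by rewrite exprn_gt0.
apply: ler_pM => //; first by rewrite exprn_ge0// mulr_ge0 ?mulr_ge0// invr_ge0 ltW.
  lra.
apply: lerXn2r; rewrite ?nnegrE; first by rewrite mulr_ge0 ?mulr_ge0// invr_ge0 ltW.
  by rewrite divr_ge0 ?sqr_ge0.
rewrite mulrC ler_pdivrMr//; lra.
Qed.

(** The error is v_1 times the relative fluctuation of the sum of the other v_j, plus the averaged
    row noise. Separating the two costs 4^m, so each is held to r^2 / 256; hence 1152 = 256 9/2 and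
    384 = 256 3/2. *)
Lemma row_statistic_moment r m : 0 < lambda -> (0 < N)%N -> (0 < m)%N ->
  6 * m%:R <= N%:R * rho ->
  1152 * m%:R <= N%:R * rho * r ^+ 2 ->
  384 * m%:R <= lambda ^+ 2 * rho ^+ 2 * N%:R * r ^+ 2 ->
  Ex P (fun t => (\sum_j (if j == i0 then 0 else (lambda * rho * N%:R)^-1) * Y t i0 j - v i0 t) ^+ (2 * m)) <=
  8 * (r ^+ 2 / 64) ^+ m.
Proof.
move=> l0 N0 m0 h1 h2 h3; have /andP[rho0 rho1] := rho01.
have N0' : 0 < N%:R :> R by rewrite ltr0n.
pose Q1 t := \sum_(j in J) W i0 j t.
pose Q2 t := \sum_(j in J) (v j t - rho).
have mQ1 : allmom P Q1 by exact: allmom_sum.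
have mQ2 : allmom P Q2 by apply: allmom_sum => j; apply: allmomB => //; exact: allmom_cst.
have c1 : 0 < lambda * rho * N%:R by rewrite !mulr_gt0.
have c2 : 0 < N%:R * rho by rewrite mulr_gt0.
have xiE t : \sum_j (if j == i0 then 0 else (lambda * rho * N%:R)^-1) * Y t i0 j - v i0 t =
    v i0 t * (Q2 t / (N%:R * rho)) + Q1 t / (lambda * rho * N%:R).
  have -> : \sum_j (if j == i0 then 0 else (lambda * rho * N%:R)^-1) * Y t i0 j =
      (lambda * rho * N%:R)^-1 * \sum_(j in J) (lambda * v i0 t * v j t + W i0 j t).
    rewrite mulr_sumr [RHS]big_mkcond; apply: eq_bigr => j _.
    by rewrite !inE; case: eqP => _; rewrite ?mul0r.
  have Q2E : \sum_(j in J) v j t = Q2 t + N%:R * rho.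
    by rewrite /Q2 sumrB sumr_const cardJ mulr_natl subrK.
  rewrite big_split /= -mulr_sumr Q2E -/(Q1 t).
  by field; rewrite !gt_eqF.
under eq_fun do rewrite xiE.
apply: (@le_trans _ _ (4 ^+ m * (((N%:R * rho) ^- (2 * m)) * Ex P (fun t => Q2 t ^+ (2 * m)) +
    ((lambda * rho * N%:R) ^- (2 * m)) * Ex P (fun t => Q1 t ^+ (2 * m))))).
  rewrite -!ExZ ?ExD; try exact: allmomX; try by (apply: allmomZ; exact: allmomX).
  rewrite -ExD; try by (apply: allmomZ; exact: allmomX).
  rewrite -ExZ; last by apply: allmomD; apply: allmomZ; exact: allmomX.
  apply: le_Ex.
  - apply: allmomX; apply: allmomD; last by apply: allmomM => //; exact: allmom_cst.
    by apply: allmomM => //; apply: allmomM => //; exact: allmom_cst.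
  - by apply: allmomZ; apply: allmomD; apply: allmomZ; exact: allmomX.
  - move=> t; rewrite -!exprVn -!exprMn.
    have nE (z : R) : z ^+ (2 * m) = `|z| ^+ (2 * m) by rewrite !exprM real_normK ?num_real.
    rewrite nE [(_^-1 * Q2 t) ^+ _]nE [(_^-1 * Q1 t) ^+ _]nE.
    have -> : 4 ^+ m = 2 ^+ (2 * m) :> R by rewrite exprM; congr (_ ^+ _); ring.
    apply: le_trans (exprD_le _ (normr_ge0 _) (normr_ge0 _)).
    apply: lerXn2r; rewrite ?nnegrE ?addr_ge0//.
    apply: (le_trans (ler_normD _ _)); rewrite [Q1 t / _]mulrC lerD2r [Q2 t / _]mulrC.
    by case: (v01 i0 t) => ->; rewrite ?mul0r ?normr0 ?mul1r.
have i1 : (N%:R * rho) ^- (2 * m) * Ex P (fun t => Q2 t ^+ (2 * m)) <= 4 * (r ^+ 2 / 256) ^+ m.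
  apply: (@le_trans _ _ ((N%:R * rho) ^- (2 * m) * (4 * (9 / 2 * m%:R * (N%:R * rho)) ^+ m))).
    by rewrite ler_wpM2l ?row_size_moment// invr_ge0 exprn_ge0// ltW.
  rewrite mulrCA exprM -exprVn -exprMn ler_wpM2l//.
  have c20 := ltW c2.
  apply: lerXn2r; rewrite ?nnegrE; first by rewrite mulr_ge0 ?invr_ge0 ?sqr_ge0// mulr_ge0.
    by rewrite divr_ge0 ?sqr_ge0.
  rewrite mulrC ler_pdivrMr ?exprn_gt0// expr2 [leRHS]mulrA ler_wpM2r//; lra.
have i2 : (lambda * rho * N%:R) ^- (2 * m) * Ex P (fun t => Q1 t ^+ (2 * m)) <= 4 * (r ^+ 2 / 256) ^+ m.
  apply: (@le_trans _ _ ((lambda * rho * N%:R) ^- (2 * m) * (4 * (3 / 2 * m%:R * N%:R) ^+ m))).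
    by rewrite ler_wpM2l ?row_noise_moment// invr_ge0 exprn_ge0// ltW.
  rewrite mulrCA exprM -exprVn -exprMn ler_wpM2l//.
  apply: lerXn2r; rewrite ?nnegrE; first by rewrite mulr_ge0 ?invr_ge0 ?sqr_ge0// mulr_ge0.
    by rewrite divr_ge0 ?sqr_ge0.
  rewrite mulrC ler_pdivrMr ?exprn_gt0//.
  have -> : r ^+ 2 / 256 * (lambda * rho * N%:R) ^+ 2 =
     (lambda ^+ 2 * rho ^+ 2 * N%:R * r ^+ 2 / 256) * N%:R by ring.
  rewrite ler_wpM2r//; lra.
apply: (le_trans (ler_wpM2l _ (lerD i1 i2))); first by rewrite exprn_ge0.
have -> : r ^+ 2 / 64 = 4 * (r ^+ 2 / 256) by field.
by set q := r ^+ 2 / 256; rewrite [(4 * q) ^+ m]exprMn le_eqVlt; apply/orP; left; apply/eqP; ring.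
Qed.

Lemma mmse_upper_bound (r : R) (D : nat) : 0 < r < 1 -> (1 <= D)%N -> odd D ->
  let L := ln 8 + 2 * D%:R * ln (9 / rho) in
  24 / r * Num.sqrt L * Num.min 1 (1 / (rho * Num.sqrt n%:R)) <= lambda ->
  324 / (r ^+ 2 * n%:R) * L <= rho <= 1 / 2 ->
  (mmse_le P D Y (v i0) <= ((D ^ 2)%:R * r ^+ D.-1)%:E)%E.
Proof.
move=> r01 D1 oD L lamge /andP[rhoge rho2].
have /andP[r0 r1] := r01; have /andP[rho0 rho1] := rho01.
have [k Dk] : exists k, D = k.*2.+1.
  by exists D./2; rewrite -[LHS]odd_double_half oD.
have D0' : 1 <= D%:R :> R by rewrite ler1n.
have n0' : 0 < n%:R :> R by rewrite ltr0n.
have r2 : 0 < r ^+ 2 by rewrite exprn_gt0.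
have r2' : r ^+ 2 < 1 by rewrite expr_lt1// ltW.
(* Since rho <= 1/2, ln (9 / rho) >= ln 18 >= 5/2. With m <= D, this converts bounds by L into the
   moment conditions on m. *)
have L5 : 5 * D%:R <= L.
  have l8 : 0 <= ln 8 :> R by rewrite ln_ge0// ler1n.
  have l18 : 5 / 2 <= ln (9 / rho).
    apply: (le_trans ln18_ge); rewrite ler_ln ?posrE//; last by rewrite divr_gt0.
    by rewrite ler_pdivlMr//; lra.
  rewrite /L; nra.
have L0 : 0 < L by lra.
have sL : Num.sqrt L ^+ 2 = L by rewrite sqr_sqrtr// ltW.
have sL0 : 0 < Num.sqrt L by rewrite sqrtr_gt0.
have sn : Num.sqrt n%:R ^+ 2 = n%:R :> R by rewrite sqr_sqrtr// ltW.
have sn0 : 0 < Num.sqrt n%:R :> R by rewrite sqrtr_gt0.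
have rn0 : 0 < rho * Num.sqrt n%:R by rewrite mulr_gt0.
have rhon : 324 * L <= rho * n%:R * r ^+ 2.
  move: rhoge; rewrite mulrAC ler_pdivrMr ?mulr_gt0//; lra.
have c0 : 0 < 24 / r * Num.sqrt L by rewrite mulr_gt0// divr_gt0.
have csq x : 24 / r * Num.sqrt L <= x -> 576 * L <= x ^+ 2 * r ^+ 2.
  move=> h; have : (24 / r * Num.sqrt L) ^+ 2 <= x ^+ 2.
    by apply: lerXn2r; rewrite ?nnegrE ?(ltW c0)//; exact: le_trans (ltW c0) h.
  rewrite exprMn sL expr_div_n mulrAC ler_pdivrMr//; lra.
have mD m : (0 < m <= k.*2.+1)%N -> (0 < m)%N /\ m%:R <= D%:R :> R.
  by rewrite -Dk => /andP[m0 mD]; split=> //; rewrite ler_nat.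
have -> : D.-1 = k.*2 by rewrite Dk.
(* The case decides which member is the minimum, and with it the statistic: the corner entry if rho
   sqrt(n) <= 1, the row sum otherwise. *)
have [rn1|rn1] := leP (rho * Num.sqrt n%:R) 1.
  have lam1 : 24 / r * Num.sqrt L <= lambda.
    move: lamge; rewrite min_l ?mulr1//.
    by rewrite div1r invf_ge1.
  have l0 : 0 < lambda by exact: lt_le_trans lam1.
  have h := csq _ lam1.
  rewrite Dk; apply: (mmse_upper_of_moments (a := fun j => if j == i0 then lambda^-1 else 0)) => //.
  move=> m /mD[m0 mD']; apply: corner_statistic_moment => //; lra.
have lam1 : 24 / r * Num.sqrt L <= lambda * (rho * Num.sqrt n%:R).
  move: lamge; rewrite min_r; last by rewrite div1r invf_le1// ltW.
  by rewrite mul1r ler_pdivrMr.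
have l0 : 0 < lambda.
  by rewrite -(pmulr_lgt0 _ rn0); exact: lt_le_trans lam1.
have h : 576 * L <= lambda ^+ 2 * rho ^+ 2 * n%:R * r ^+ 2.
  have := csq _ lam1; rewrite !exprMn sn; lra.
(* Follows from 324 L <= rho n r^2 <= n. Then N = n - 1 is at least 9 n / 10, a loss that the
   constants 324 and 576 absorb. *)
have nbig : 10 <= n%:R :> R.
  have : rho * n%:R * r ^+ 2 <= 1 * n%:R * 1 by apply: ler_pM => //; nra.
  lra.
have NE : N%:R = n%:R - 1 :> R by rewrite /N -subn1 natrB.
have N9 : 9 / 10 * n%:R <= N%:R :> R by rewrite NE; lra.
have N0 : (0 < N)%N by rewrite -(ltr_nat R); lra.
have k1 : 9 / 10 * (rho * n%:R * r ^+ 2) <= N%:R * rho * r ^+ 2.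
  rewrite (_ : 9 / 10 * _ = 9 / 10 * n%:R * (rho * r ^+ 2)); last by ring.
  by rewrite -[leRHS]mulrA ler_wpM2r// mulr_ge0 ?sqr_ge0 ?ltW.
have k2 : 9 / 10 * (lambda ^+ 2 * rho ^+ 2 * n%:R * r ^+ 2) <= lambda ^+ 2 * rho ^+ 2 * N%:R * r ^+ 2.
  have -> : 9 / 10 * (lambda ^+ 2 * rho ^+ 2 * n%:R * r ^+ 2) = (lambda ^+ 2 * rho ^+ 2 * r ^+ 2) * (9 / 10 * n%:R) by ring.
  have -> : lambda ^+ 2 * rho ^+ 2 * N%:R * r ^+ 2 = (lambda ^+ 2 * rho ^+ 2 * r ^+ 2) * N%:R by ring.
  by rewrite ler_wpM2l// mulr_ge0 ?sqr_ge0// mulr_ge0 ?sqr_ge0.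
have k3 : N%:R * rho * r ^+ 2 <= N%:R * rho.
  by rewrite ler_piMr ?(ltW r2')// mulr_ge0// (ltW rho0).
rewrite Dk; apply: (mmse_upper_of_moments (a := fun j => if j == i0 then 0 else (lambda * rho * N%:R)^-1)) => //.
move=> m /mD[m0 mD']; apply: row_statistic_moment => //; lra.
Qed.
End upper_bound.

Theorem mainTheorem2 (R : realType) (d : measure_display) (T : measurableType d)
  (P : probability T R) (n : nat) (hn : (0 < n)%N) (lambda rho : R)
  (v : 'I_n -> {RV P >-> R}) (W : 'I_n -> 'I_n -> {RV P >-> R}) :
  0 <= lambda -> 0 < rho < 1 ->
  @planted_submatrix_model R d T P n rho v W ->
  let Y := observation lambda v W in
  let x := (v (Ordinal hn) : T -> R) in
  let m := Num.min 1 (1 / (rho * Num.sqrt n%:R)) in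
  (forall (r : R) (D : nat), 0 < r < 1 -> (1 <= D)%N ->
     lambda <= r / (D * D.+1)%:R * m ->
     ((rho - rho ^+ 2 / (1 - r ^+ 2) ^+ 2)%:E <= mmse_le P D Y x)%E)
  /\
  (forall (r : R) (D : nat), 0 < r < 1 -> (1 <= D)%N -> odd D ->
     let L := ln 8 + 2 * D%:R * ln (9 / rho) in
     24 / r * Num.sqrt L * m <= lambda ->
     324 / (r ^+ 2 * n%:R) * L <= rho <= 1 / 2 ->
     (mmse_le P D Y x <= ((D ^ 2)%:R * r ^+ D.-1)%:E)%E).
Proof.
move=> lambda0 rho01 model; split.
  move=> r D r01 D1; exact: (mmse_lower_bound hn lambda0 rho01 model r01 D1).
move=> r D r01 D1 oD; exact: (mmse_upper_bound hn lambda0 rho01 model r01 D1 oD).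
Qed.
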